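(* Let $a,b,m$ be positive integers, $\tilde d_m=a+b+m/2-2$, and let $\tilde K_{a,b}(u;m)$ be as in the context. The following identities of functions of $u\in\mathbb C\setminus[1,\infty)$ hold: $$\tilde K_{a,b}(u;m+2)=\Big(\tilde d_m+u\frac{d}{du}\Big)\tilde K_{a,b}(u;m),$$ $$\tilde K_{a,b+1}(u;m)=\frac1b\frac{d}{du}\tilde K_{a,b}(u;m),$$ $$\tilde K_{a,b+1}(u;m)=\Big(1+\frac1b\,u\frac{d}{du}\Big)\tilde K_{a+1,b}(u;m).$$ Moreover, wherever $\tilde K_{a,b}(u;m)\neq0$, $$\frac{a+b}{\tilde d_m}\,\frac{\tilde K_{a+1,b}(u;m)}{\tilde K_{a,b}(u;m)}=\frac{{}_2F_1(\tilde d_m+1,b;a+b+1;u)}{{}_2F_1(\tilde d_m,b;a+b;u)}$$ (the right-hand side being the quotient expanded by Gauss's continued fraction).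
   Context: For positive integers $a,b,m$, $$\tilde K_{a,b}(u;m)=\frac{\Gamma(\tilde d_m(a,b))}{\Gamma(a+b)}\,{}_2F_1\big(\tilde d_m(a,b),b;a+b;u\big),\qquad \tilde d_m(a,b)=a+b+\tfrac m2-2 ,$$ with ${}_2F_1$ the Gauss hypergeometric function (analytically continued to $\mathbb C\setminus[1,\infty)$). In the identities $\tilde d_m$ without arguments means $\tilde d_m(a,b)$; in e.g. $\tilde K_{a+1,b}$ the parameter is $\tilde d_m(a+1,b)$. *)

(* Defs.v *)
From Stdlib Require Import Reals Factorial ClassicalEpsilon.
From Coquelicot Require Import Coquelicot.

Open Scope R_scope.

(* Euler's integral; meaningful for x > 0, which is the only range used. *)
Definition Gamma (x : R) : R :=
  RInt_gen (fun t => Rpower t (x - 1) * exp (- t))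
           (at_right 0) (Rbar_locally p_infty).

Definition cut_plane (u : C) : Prop :=
  ~ exists x : R, 1 <= x /\ u = RtoC x.

(* Rising factorial z (z + 1) ... (z + n - 1). *)
Fixpoint pochhammer (z : C) (n : nat) : C :=
  match n with
  | O => RtoC 1
  | S k => (pochhammer z k * (z + RtoC (INR k)))%C
  end.

Definition hyp2F1_coef (alpha beta gamma : C) (n : nat) : C :=
  (pochhammer alpha n * pochhammer beta n
   / (pochhammer gamma n * RtoC (INR (fact n))))%C.

Definition C_analytic_at (f : C -> C) (z0 : C) : Prop :=
  exists (c : nat -> C) (r : R), 0 < r /\
    forall z : C, Cmod (z - z0)%C < r ->
      @is_pseries C_AbsRing C_NormedModule c (z - z0)%C (f z).

Definition is_hyp2F1 (alpha beta gamma : C) (f : C -> C) : Prop :=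
  (forall u : C, Cmod u < 1 ->
     @is_pseries C_AbsRing C_NormedModule (hyp2F1_coef alpha beta gamma) u (f u))
  /\ (forall u : C, cut_plane u -> C_analytic_at f u).

(* The analytic continuation of the Gauss series to the cut plane.  When gamma
   is not a nonpositive integer it exists and, the cut plane being connected, it
   is unique there; the values on the cut itself are arbitrary. *)
Definition hyp2F1 (alpha beta gamma : C) : C -> C :=
  epsilon (inhabits (fun _ : C => RtoC 0)) (is_hyp2F1 alpha beta gamma).

Definition dtilde (m a b : nat) : R := INR a + INR b + INR m / 2 - 2.

Definition Ktilde (a b : nat) (u : C) (m : nat) : C :=
  (RtoC (Gamma (dtilde m a b)) / RtoC (Gamma (INR (a + b)))
   * hyp2F1 (RtoC (dtilde m a b)) (RtoC (INR b)) (RtoC (INR (a + b))) u)%C.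

(* Coquelicot's [C_derive f z] is a total function, defined from limits along the
   horizontal line through z; it is the complex derivative only together with
   this predicate. *)
Definition C_differentiable_at (f : C -> C) (z : C) : Prop :=
  @ex_derive C_AbsRing C_NormedModule f z.

(* Main.v *)
Require Import Defs.
From Stdlib Require Import Reals Factorial Arith Lra Lia ClassicalEpsilon.
From Coquelicot Require Import Coquelicot.

(** The function [Ktilde] only involves [2F1 (N/2, p+1; p+q+2; u)] with [N], [p],
    [q] natural numbers, [N > 0], because its first parameter is a positive
    half-integer and its other two are integers.  For such parameters Euler's
    integral
      [I p q N u = int_0^1 t^p (1-t)^q (1 - u t)^(-N/2) dt]
    has a polynomial weight and converges at every point of the cut plane, and
    the half-integer power is the [N]-th power of the principal inverse square
    root, so that no complex logarithm is required.

    With [b = p+1] and [a = q+1], the four claims then become statements about [I].  Differentiating under the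
    integral gives [I' p q N = N/2 * I (p+1) q (N+2)], which is the second
    identity up to constants.  The pointwise relation
    [w^(-N/2-1) = w^(-N/2) + u t w^(-N/2-1)], for [w = 1 - u t], gives the first
    ([euler_integral_contiguous]).  Integrating the derivative of
    [t^(p+1) (1-t)^(q+1) w^(-N/2)] over [[0,1]] gives the third
    ([euler_integral_by_parts]).  The constants match because of
    [Gamma (x+1) = x Gamma x] ([Gamma_succ]) and the value
    [p! q! / (p+q+1)!] of the Beta integral.  The last claim follows from the
    functional equation of [Gamma] alone.

    It remains to identify [hyp2F1] with the integral ([hyp2F1_euler]).  This
    takes two facts.

    - [I] is analytic on the cut plane and has the hypergeometric expansion on
      the unit disc.  Both follow from one estimate,
      [euler_integral_remainder]: if [|1 - t z| >= d] on [[0,1]], the Taylor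
      series of [I] at [z] converges to [I] on the whole disc of radius [d]
      about [z].  At [z = 0] one may take [d = 1], and the coefficients are Beta
      integrals.  The estimate is obtained under the integral sign from the
      remainder of the binomial series ([binomial_remainder]), itself bounded by
      moving the centre of the Taylor polynomial along a segment.

    - An analytic function on the cut plane is determined by its values on the
      unit disc ([identity_theorem_cut_plane]): the cut plane is star-shaped
      about 0, and zeros propagate along each ray because a power series whose
      zeros accumulate at its centre vanishes. *)

Open Scope R_scope.

(* Equations between complex numbers often come with the carrier of an
   algebraic structure as their type, which hides them from [ring] and [field]. *)
Ltac as_C_equation := match goal with |- ?a = ?b => change (@eq C a b) end.

(** * Derivatives of complex-valued functions of a real variable *)

(** A form of differentiability in which only an inequality has to be checked;
    it serves for real and for complex variables alike. *)
Lemma is_derive_quadratic {K : AbsRing} {V : NormedModule K}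
  (f : K -> V) (x : K) (l : V) (M : R) :
  locally x (fun y => norm (minus (minus (f y) (f x)) (scal (minus y x) l))
                      <= M * abs (minus y x) ^ 2) ->
  is_derive f x l.
Proof.
  intros [d Hd]. split.
  - apply is_linear_scal_l.
  - intros y Hy.
    pose proof (is_filter_lim_locally_unique x y Hy) as E. subst y.
    intros eps.
    pose (M' := Rmax M 1).
    assert (HM' : 0 < M') by (apply Rlt_le_trans with 1; [lra | apply Rmax_r]).
    assert (Hp : 0 < Rmin d (eps / M')).
    { apply Rmin_pos. apply cond_pos. apply Rdiv_lt_0_compat; [apply cond_pos | exact HM']. }
    exists (mkposreal _ Hp). intros y Hy2.
    assert (H1 : ball x d y).
    { apply ball_le with (2 := Hy2). apply Rmin_l. }
    eapply Rle_trans. apply Hd. exact H1.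
    change (norm (minus y x)) with (abs (minus y x)).
    assert (H2 : abs (minus y x) < eps / M').
    { apply Rlt_le_trans with (1 := Hy2). apply Rmin_r. }
    assert (H3 : 0 <= abs (minus y x)) by apply abs_ge_0.
    apply Rle_trans with (M' * abs (minus y x) ^ 2).
    apply Rmult_le_compat_r. apply pow2_ge_0. apply Rmax_l.
    replace (M' * abs (minus y x) ^ 2) with ((M' * abs (minus y x)) * abs (minus y x)) by ring.
    apply Rmult_le_compat_r. exact H3.
    apply Rmult_le_reg_r with (/ M'). now apply Rinv_0_lt_compat.
    replace (M' * abs (minus y x) * / M') with (abs (minus y x)) by (field; lra).
    apply Rlt_le, H2.
Qed.

Lemma is_derive_C_components (f : R -> C) (x : R) (l : C) :
  is_derive (V := C_R_NormedModule) f x l <->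
  is_derive (fun t => Re (f t)) x (Re l) /\ is_derive (fun t => Im (f t)) x (Im l).
Proof.
  split.
  - intros H; split.
    + apply (filterdiff_comp' f (fun z : C_R_NormedModule => fst z) x _ (fun z => fst z) H).
      apply filterdiff_linear. apply is_linear_fst.
    + apply (filterdiff_comp' f (fun z : C_R_NormedModule => snd z) x _ (fun z => snd z) H).
      apply filterdiff_linear. apply is_linear_snd.
  - intros [H1 H2].
    apply (is_derive_scal_l (V := C_R_NormedModule) _ x (Re l) (1, 0)) in H1.
    apply (is_derive_scal_l (V := C_R_NormedModule) _ x (Im l) (0, 1)) in H2.
    generalize (is_derive_plus _ _ _ _ _ H1 H2).
    intros H3. replace l with (@plus C_R_NormedModule (scal (Re l) (1, 0)) (scal (Im l) (0, 1)) : C).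
    1: revert H3; apply is_derive_ext; intros t.
    all: apply injective_projections; simpl; unfold plus, scal; simpl;
      unfold mult, prod_scal, plus; simpl; unfold scal; simpl; unfold mult; simpl;
      unfold Re, Im; ring.
Qed.

Lemma is_derive_Cmult (f g : R -> C) (x : R) (df dg : C) :
  is_derive (V := C_R_NormedModule) f x df ->
  is_derive (V := C_R_NormedModule) g x dg ->
  is_derive (V := C_R_NormedModule) (fun t => f t * g t)%C x (df * g x + f x * dg)%C.
Proof.
  intros [F1 F2]%is_derive_C_components [G1 G2]%is_derive_C_components.
  apply is_derive_C_components; split.
  - apply is_derive_ext with (fun t => Re (f t) * Re (g t) - Im (f t) * Im (g t)).
    intros t; symmetry; apply re_mult.
    evar_last.
    apply (is_derive_minus (V := R_NormedModule));
     apply (is_derive_mult (K := R_AbsRing)); eauto; intros; apply Rmult_comm.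
    rewrite re_plus, !re_mult. simpl. unfold minus, plus, opp, mult; simpl. ring.
  - apply is_derive_ext with (fun t => Re (f t) * Im (g t) + Im (f t) * Re (g t)).
    intros t; symmetry; apply im_mult.
    evar_last.
    apply (is_derive_plus (V := R_NormedModule));
     apply (is_derive_mult (K := R_AbsRing)); eauto; intros; apply Rmult_comm.
    rewrite im_plus, !im_mult. simpl. unfold minus, plus, opp, mult; simpl. ring.
Qed.

Lemma is_derive_Cconst (c : C) (x : R) :
  is_derive (V := C_R_NormedModule) (fun _ => c) x (RtoC 0).
Proof. apply (is_derive_const (V := C_R_NormedModule)). Qed.

Lemma is_derive_RtoC (f : R -> R) (x l : R) :
  is_derive f x l -> is_derive (V := C_R_NormedModule) (fun t => RtoC (f t)) x (RtoC l).
Proof.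
  intros H. apply is_derive_C_components; split; simpl; [exact H | apply (is_derive_const (V := R_NormedModule))].
Qed.

Lemma is_derive_Cpow (f : R -> C) (n : nat) (x : R) (l : C) :
  is_derive (V := C_R_NormedModule) f x l ->
  is_derive (V := C_R_NormedModule) (fun t => f t ^ n)%C x
    (RtoC (INR n) * l * f x ^ (pred n))%C.
Proof.
  intros H. induction n as [|n IH].
  - simpl. evar_last. apply is_derive_Cconst. ring.
  - evar_last. simpl. apply is_derive_Cmult; [exact H | exact IH].
    rewrite S_INR, RtoC_plus. destruct n; simpl; ring.
Qed.

(** The mean value theorem fails for complex values, but the mean value inequality
    survives: apply the real theorem to the component of [F] in the direction of
    the increment [F b - F a]. *)
Lemma Cmod_mean_value (F dF : R -> C) (a b M : R) :
  a <= b ->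
  (forall t, a <= t <= b -> is_derive (V := C_R_NormedModule) F t (dF t)) ->
  (forall t, a <= t <= b -> Cmod (dF t) <= M) ->
  Cmod (F b - F a) <= M * (b - a).
Proof.
  intros Hab HF HM.
  set (D := (F b - F a)%C).
  assert (HD : forall t, a <= t <= b ->
    is_derive (fun t => Re (Cconj D * F t)%C) t (Re (Cconj D * dF t)%C)).
  { intros t Ht.
    assert (H : is_derive (V := C_R_NormedModule) (fun t => Cconj D * F t)%C t (Cconj D * dF t)%C).
    { evar_last. apply (is_derive_Cmult (fun _ => Cconj D) F).
      apply is_derive_Cconst. apply HF, Ht. ring. }
    apply is_derive_C_components in H. apply H. }
  destruct (MVT_gen (fun t => Re (Cconj D * F t)%C) a b (fun t => Re (Cconj D * dF t)%C))
    as [c [Hc E]].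
  - rewrite Rmin_left, Rmax_right by exact Hab. intros t Ht. apply HD; lra.
  - rewrite Rmin_left, Rmax_right by exact Hab. intros t Ht.
    apply derivable_continuous_pt. eexists. apply is_derive_Reals, HD, Ht.
  - rewrite Rmin_left, Rmax_right in Hc by exact Hab.
    assert (E2 : Cmod D * Cmod D = Re (Cconj D * dF c)%C * (b - a)).
    { rewrite <- E.
      replace (Re (Cconj D * F b)%C - Re (Cconj D * F a)%C) with (Re (Cconj D * D)%C).
      2:{ unfold D. rewrite !re_mult. unfold Cminus. rewrite re_plus, im_plus, re_opp, im_opp. ring. }
      rewrite Cmult_comm, <- Cmod2_conj. rewrite re_RtoC. ring. }
    assert (E3 : Re (Cconj D * dF c)%C <= Cmod D * M).
    { apply Rle_trans with (1 := Rle_abs _). eapply Rle_trans. apply re_le_Cmod.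
      rewrite Cmod_mult, Cmod_conj. apply Rmult_le_compat_l. apply Cmod_ge_0. now apply HM. }
    destruct (Cmod_ge_0 D) as [P|P].
    + apply Rmult_le_reg_l with (1 := P). rewrite E2.
      rewrite <- Rmult_assoc. apply Rmult_le_compat_r; lra.
    + rewrite <- P. apply Rmult_le_pos; [|lra].
      apply Rle_trans with (1 := Cmod_ge_0 (dF a)). apply HM; lra.
Qed.

(** * The principal inverse square root *)

(** The plane cut along the nonpositive reals: [|s| + Re s] is always nonnegative
    and vanishes exactly on the cut. *)
Definition slit (s : C) : Prop := 0 < Cmod s + Re s.

(** From [(s + |s|)^2 = 2 s (|s| + Re s)]: the square root of [s] is
    [(s + |s|) / sqrt (2 (|s| + Re s))], and this is its inverse. *)
Definition rsqrtC (s : C) : C :=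
  (RtoC (/ (Cmod s * sqrt (2 * (Cmod s + Re s)))) * (Cconj s + RtoC (Cmod s)))%C.

Lemma slit_Cmod s : slit s -> 0 < Cmod s.
Proof.
  unfold slit. intros H. pose proof (re_le_Cmod s). pose proof (Rle_abs (Re s)).  lra.
Qed.

Lemma rsqrtC_sqr s : slit s -> (rsqrtC s ^ 2 * s = 1)%C.
Proof.
  intros H. pose proof (slit_Cmod s H) as H0. red in H.
  assert (Hq : 0 < sqrt (2 * (Cmod s + Re s))) by (apply sqrt_lt_R0; lra).
  assert (E : (Cconj s * s)%C = RtoC (Cmod s ^ 2)) by (rewrite Cmod2_conj; ring).
  assert (E2 : (Cconj s + s)%C = RtoC (2 * Re s)).
  { apply injective_projections; simpl; unfold Re, Im; ring. }
  unfold rsqrtC.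
  replace ((RtoC (/ (Cmod s * sqrt (2 * (Cmod s + Re s)))) * (Cconj s + RtoC (Cmod s))) ^ 2 * s)%C
   with (RtoC (/ (Cmod s * sqrt (2 * (Cmod s + Re s)))) ^ 2 *
    ((Cconj s + 2 * RtoC (Cmod s)) * (Cconj s * s)
       +  RtoC (Cmod s) ^ 2 * s))%C by ring.
  rewrite E. rewrite RtoC_pow.
  replace ((Cconj s + 2 * Cmod s) * Cmod s ^ 2 + Cmod s ^ 2 * s)%C
   with (Cmod s ^ 2 * (2 * Cmod s + (Cconj s + s)))%C by ring.
  rewrite E2. rewrite <- RtoC_mult, <- RtoC_plus, <- !RtoC_pow, <- !RtoC_mult. f_equal.
  rewrite pow_inv, Rpow_mult_distr, pow2_sqrt by lra. field. lra.
Qed.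

(** The sign of the real part is what singles out the branch. *)
Lemma rsqrtC_Re s : slit s -> 0 < Re (rsqrtC s).
Proof.
  intros H. pose proof (slit_Cmod s H) as H0. red in H.
  unfold rsqrtC. rewrite re_scal_l, re_plus, re_conj, re_RtoC.
  apply Rmult_lt_0_compat; [|lra].
  apply Rinv_0_lt_compat, Rmult_lt_0_compat. exact H0. apply sqrt_lt_R0; lra.
Qed.

Lemma rsqrtC_Cmod s : slit s -> Cmod (rsqrtC s) ^ 2 * Cmod s = 1.
Proof.
  intros H. rewrite <- Cmod_pow, <- Cmod_mult, rsqrtC_sqr by exact H. apply Cmod_1.
Qed.

Lemma rsqrtC_1 : rsqrtC 1 = 1.
Proof.
  unfold rsqrtC. rewrite Cmod_1. simpl.
  replace (2 * (1+1)) with (2*2) by ring. rewrite sqrt_square by lra.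
  apply injective_projections; simpl; field.
Qed.

Lemma slit_open s : slit s ->
  exists e : posreal, forall s', Cmod (s' - s)%C < e -> slit s'.
Proof.
  intros H. assert (P : 0 < (Cmod s + Re s) / 2) by (red in H; lra).
  exists (mkposreal _ P). simpl. intros s' Hs'. unfold slit.
  pose proof (re_le_Cmod (s' - s)%C) as H1. unfold Cminus in H1 at 1.
  rewrite re_plus, re_opp in H1.
  pose proof (Rle_abs (- (Re s' + - Re s))) as H2. rewrite Rabs_Ropp in H2.
  pose proof (Cmod_triangle s' (- (s' - s))%C) as H3. rewrite Cmod_opp in H3.
  replace (s' + - (s' - s))%C with s in H3 by ring. lra.
Qed.

(** With [x] and [y] the values at [s] and [s'], and [d = s' - s], the relations
    [x^2 s = y^2 s' = 1] give [(y - x) (y + x) = - d x^2 y^2].  Both real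
    parts are positive, so [|y + x| >= Re x], which bounds [y - x] by a multiple
    of [d].  Feeding this back into
    [(y - x + x^3 d / 2) (y + x) = d x^2 (x - y) (y + x / 2)]
    bounds the second-order error. *)
Lemma rsqrtC_expansion s : slit s ->
  exists M, 0 <= M /\ forall s', slit s' -> Cmod (s' - s)%C <= Cmod s / 2 ->
  Cmod (rsqrtC s' - rsqrtC s + / 2 * rsqrtC s ^ 3 * (s' - s))%C
    <= M * Cmod (s' - s)%C ^ 2.
Proof.
  intros Hs.
  pose proof (rsqrtC_sqr s Hs) as E. pose proof (rsqrtC_Cmod s Hs) as F.
  pose proof (rsqrtC_Re s Hs) as P. pose proof (slit_Cmod s Hs) as S0.
  set (x := rsqrtC s) in *. set (r := Re x) in *. set (p := Cmod x) in *.
  assert (Hp : 0 <= p) by apply Cmod_ge_0.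
  assert (Hp2 : 0 <= p ^ 2) by (apply pow_le; lra).
  exists (12 * p ^ 7 / r ^ 2). split.
  { apply Rmult_le_pos. apply Rmult_le_pos; [lra | now apply pow_le].
    apply Rlt_le, Rinv_0_lt_compat, pow_lt, P. }
  intros s' Hs' Hd.
  pose proof (rsqrtC_sqr s' Hs') as E'. pose proof (rsqrtC_Cmod s' Hs') as F'.
  pose proof (rsqrtC_Re s' Hs') as P'.
  set (y := rsqrtC s') in *. set (q := Cmod y) in *.
  assert (Hq : 0 <= q) by apply Cmod_ge_0.
  set (d := (s' - s)%C) in *.
  assert (H1 : ((y - x) * (y + x) = - (d * x ^ 2 * y ^ 2))%C).
  { replace ((y - x) * (y + x))%C with (y ^ 2 * 1 - x ^ 2 * 1)%C by ring.
    rewrite <- E at 1. rewrite <- E'. unfold d. ring. }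
  assert (H2 : ((y - x + / 2 * x ^ 3 * d) * (y + x) = d * x ^ 2 * (x - y) * (y + / 2 * x))%C).
  { replace ((y - x + / 2 * x ^ 3 * d) * (y + x))%C with ((y - x) * (y + x) + / 2 * x ^ 3 * d * (y + x))%C by ring.
    rewrite H1. field. }
  assert (Hs2 : Cmod s / 2 <= Cmod s').
  { pose proof (Cmod_triangle s' (- d)%C) as T. rewrite Cmod_opp in T.
    replace (s' + - d)%C with s in T by (unfold d; ring). lra. }
  assert (Hq2 : q ^ 2 <= 2 * p ^ 2).
  { apply Rmult_le_reg_r with (Cmod s' * Cmod s). apply Rmult_lt_0_compat; lra.
    replace (q ^ 2 * (Cmod s' * Cmod s)) with (q ^ 2 * Cmod s' * Cmod s) by ring.
    replace (2 * p ^ 2 * (Cmod s' * Cmod s)) with (2 * Cmod s' * (p ^ 2 * Cmod s)) by ring.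
    rewrite F, F'. lra. }
  assert (Hq3 : q <= 2 * p).
  { apply Rsqr_incr_0; [|exact Hq|lra]. unfold Rsqr. nra. }
  assert (Y : r <= Cmod (y + x)%C).
  { apply Rle_trans with (Re (y + x)%C). rewrite re_plus. fold r. lra.
    eapply Rle_trans. apply Rle_abs. apply re_le_Cmod. }
  assert (D0 : 0 <= Cmod d) by apply Cmod_ge_0.
  assert (B1 : Cmod (y - x)%C * r <= 4 * p ^ 4 * Cmod d).
  { apply Rle_trans with (Cmod ((y - x) * (y + x))%C).
    rewrite Cmod_mult. apply Rmult_le_compat_l. apply Cmod_ge_0. exact Y.
    rewrite H1, Cmod_opp, !Cmod_mult, !Cmod_pow. fold p q.
    replace (4 * p ^ 4 * Cmod d) with (Cmod d * p ^ 2 * (4 * p ^ 2)) by ring.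
    apply Rmult_le_compat_l. now apply Rmult_le_pos. lra. }
  assert (B2 : Cmod (y - x + / 2 * x ^ 3 * d)%C * r <= Cmod d * p ^ 2 * Cmod (y - x)%C * (3 * p)).
  { apply Rle_trans with (Cmod ((y - x + / 2 * x ^ 3 * d) * (y + x))%C).
    rewrite Cmod_mult. apply Rmult_le_compat_l. apply Cmod_ge_0. exact Y.
    rewrite H2, !Cmod_mult, !Cmod_pow. fold p q.
    replace (Cmod (x - y)%C) with (Cmod (y - x)%C) by (rewrite <- Cmod_opp; f_equal; ring).
    apply Rmult_le_compat_l. apply Rmult_le_pos. now apply Rmult_le_pos. apply Cmod_ge_0.
    eapply Rle_trans. apply Cmod_triangle. rewrite Cmod_mult. fold p q.
    rewrite <- RtoC_inv by lra. rewrite Cmod_R, Rabs_pos_eq by lra. lra. }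
  apply Rmult_le_reg_r with (r ^ 2). now apply pow_lt.
  replace (12 * p ^ 7 / r ^ 2 * Cmod d ^ 2 * r ^ 2) with (12 * p ^ 7 * Cmod d ^ 2) by (field; lra).
  apply Rle_trans with (Cmod d * p ^ 2 * Cmod (y - x)%C * (3 * p) * r).
  { simpl. rewrite Rmult_1_r, <- Rmult_assoc. apply Rmult_le_compat_r; [lra | exact B2]. }
  replace (Cmod d * p ^ 2 * Cmod (y - x)%C * (3 * p) * r) with (Cmod d * (3 * p ^ 3) * (Cmod (y - x)%C * r)) by ring.
  replace (12 * p ^ 7 * Cmod d ^ 2) with (Cmod d * (3 * p ^ 3) * (4 * p ^ 4 * Cmod d)) by ring.
  apply Rmult_le_compat_l; [|exact B1].
  apply Rmult_le_pos. exact D0. apply Rmult_le_pos. lra. now apply pow_le.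
Qed.

Lemma is_derive_rsqrtC_line (s h : C) (t : R) :
  slit (s - t * h)%C ->
  is_derive (V := C_R_NormedModule) (fun t => rsqrtC (s - RtoC t * h)%C) t
    (/ 2 * h * rsqrtC (s - RtoC t * h) ^ 3)%C.
Proof.
  intros Ht. destruct (slit_open _ Ht) as [e He].
  destruct (rsqrtC_expansion _ Ht) as [M [HM Hexp]].
  pose proof (slit_Cmod _ Ht) as S0.
  set (e' := Rmin e (Cmod (s - t * h)%C / 2)).
  assert (E0 : 0 < e') by (apply Rmin_pos; [apply cond_pos | lra]).
  assert (E1 : 0 < e' / (Cmod h + 1)).
  { apply Rdiv_lt_0_compat. exact E0. pose proof (Cmod_ge_0 h). lra. }
  apply is_derive_quadratic with (M * Cmod h ^ 2).
  exists (mkposreal _ E1). intros y Hy.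
  change (Rabs (y - t) < e' / (Cmod h + 1)) in Hy.
  assert (Hy' : Cmod ((s - y * h) - (s - t * h))%C < e').
  { replace ((s - y * h) - (s - t * h))%C with (- (RtoC (y - t) * h))%C by (rewrite RtoC_minus; ring).
    rewrite Cmod_opp, Cmod_mult, Cmod_R. pose proof (Cmod_ge_0 h).
    apply Rle_lt_trans with (Rabs (y - t) * (Cmod h + 1)).
    apply Rmult_le_compat_l. apply Rabs_pos. lra.
    apply Rmult_lt_reg_r with (/ (Cmod h + 1)). apply Rinv_0_lt_compat; lra.
    rewrite Rmult_assoc, Rinv_r, Rmult_1_r by lra. exact Hy. }
  assert (Q := Hexp (s - y * h)%C (He _ (Rlt_le_trans _ _ _ Hy' (Rmin_l _ _)))
     (Rlt_le _ _ (Rlt_le_trans _ _ _ Hy' (Rmin_r _ _)))).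
  rewrite <- Cmod_norm. change (abs ?z) with (Rabs z).
  eapply Rle_trans; [|eapply Rle_trans; [exact Q|]].
  - apply Req_le. f_equal. as_C_equation. rewrite scal_R_Cmult. change (minus y t) with (y - t).
    transitivity (rsqrtC (s - y * h) - rsqrtC (s - t * h)
      - RtoC (y - t) * (/ 2 * h * rsqrtC (s - t * h) ^ 3))%C; [reflexivity|].
    rewrite (RtoC_minus y t). ring.
  - replace ((s - y * h) - (s - t * h))%C with (- (RtoC (y - t) * h))%C by (rewrite RtoC_minus; ring).
    rewrite Cmod_opp, Cmod_mult, Cmod_R. change (minus y t) with (y - t).
    apply Req_le. ring.
Qed.

Lemma rsqrtC_line_pow_derive (N : nat) (s h : C) (t : R) :
  slit (s - t * h)%C ->
  is_derive (V := C_R_NormedModule) (fun t => rsqrtC (s - RtoC t * h) ^ N)%C t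
    (RtoC (INR N / 2) * h * rsqrtC (s - RtoC t * h) ^ (N + 2))%C.
Proof.
  intros Ht. evar_last. apply is_derive_Cpow. now apply is_derive_rsqrtC_line.
  unfold Rdiv. rewrite RtoC_mult, RtoC_inv by lra.
  destruct N as [|N].
  - simpl. ring.
  - replace (S N + 2)%nat with (3 + N)%nat by lia. rewrite Cpow_add_r. simpl pred. ring.
Qed.

(** * The binomial series with remainder *)

Lemma sum_n_C_0 (a : nat -> C) : @sum_n C_AbelianGroup a 0 = a O.
Proof. apply (@sum_O C_AbelianGroup). Qed.

Lemma sum_n_C_S (a : nat -> C) n :
  @sum_n C_AbelianGroup a (S n) = (@sum_n C_AbelianGroup a n + a (S n))%C.
Proof. apply (@sum_Sn C_AbelianGroup). Qed.

Lemma fact_C_neq_0 n : RtoC (INR (fact n)) <> 0.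
Proof. intros H. apply RtoC_inj in H. apply (INR_fact_neq_0 n H). Qed.

(** The Taylor polynomial of [w^(-N/2)] centred at the moving point [s - t h],
    evaluated at [s - h].  It is the function itself for [t = 1] and the Taylor
    polynomial centred at [s] for [t = 0]. *)
Definition moving_taylor (N : nat) (s h : C) (n : nat) (t : R) : C :=
  @sum_n C_AbelianGroup (fun k => pochhammer (RtoC (INR N / 2)) k / RtoC (INR (fact k))
     * (h * RtoC (1 - t)) ^ k * rsqrtC (s - RtoC t * h) ^ (N + 2 * k))%C n.

(** The derivatives of consecutive terms telescope, so that only the last one
    remains. *)
Lemma is_derive_moving_taylor (N : nat) (s h : C) (n : nat) (t : R) :
  slit (s - t * h)%C ->
  is_derive (V := C_R_NormedModule) (moving_taylor N s h n) t
   (pochhammer (RtoC (INR N / 2)) (S n) / RtoC (INR (fact n)) * h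
     * (h * RtoC (1 - t)) ^ n * rsqrtC (s - RtoC t * h) ^ (N + 2 * n + 2))%C.
Proof.
  intros Ht. induction n as [|n IH].
  - apply is_derive_ext with (fun t => rsqrtC (s - RtoC t * h) ^ N)%C.
    { intros u. as_C_equation. unfold moving_taylor. rewrite sum_n_C_0. simpl pochhammer. simpl fact.
      rewrite Nat.mul_0_r, Nat.add_0_r. simpl INR. simpl Cpow. field. }
    evar_last. now apply rsqrtC_line_pow_derive. as_C_equation.
    simpl pochhammer. simpl fact. rewrite Nat.mul_0_r, Nat.add_0_r. simpl INR. simpl (Cpow (h * _)%C 0).
    field.
  - apply is_derive_ext with (fun t => moving_taylor N s h n t +
     pochhammer (RtoC (INR N / 2)) (S n) / RtoC (INR (fact (S n)))
     * ((h * RtoC (1 - t)) ^ (S n) * rsqrtC (s - RtoC t * h) ^ (N + 2 * S n)))%C.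
    { intros u. as_C_equation. unfold moving_taylor. rewrite sum_n_C_S. f_equal. ring. }
    evar_last.
    + apply (is_derive_plus (V := C_R_NormedModule)). exact IH.
      apply is_derive_Cmult. apply is_derive_Cconst.
      apply is_derive_Cmult; [|now apply rsqrtC_line_pow_derive].
      apply is_derive_Cpow. apply is_derive_Cmult. apply is_derive_Cconst.
      apply (is_derive_RtoC (fun t => 1 - t) t (-1)). auto_derive; [exact I | ring].
    + as_C_equation. change (@plus ?T ?a ?b) with (a + b)%C.
      change (pochhammer (RtoC (INR N / 2)) (S (S n))) with
        (pochhammer (RtoC (INR N / 2)) (S n) * (RtoC (INR N / 2) + RtoC (INR (S n))))%C.
      generalize (pochhammer (RtoC (INR N / 2)) (S n)). intros P.
      replace (N + 2 * n + 2)%nat with (N + 2 * S n)%nat by lia.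
      replace (RtoC (INR (N + 2 * S n) / 2)) with (RtoC (INR N / 2) + RtoC (INR (S n)))%C.
      2:{ rewrite <- RtoC_plus. f_equal. rewrite plus_INR, mult_INR. simpl (INR 2). field. }
      replace (RtoC (INR (fact (S n)))) with (RtoC (INR (S n)) * RtoC (INR (fact n)))%C.
      2:{ rewrite <- RtoC_mult, <- mult_INR. reflexivity. }
      replace (RtoC (-1)) with (- (1))%C by (apply injective_projections; simpl; ring).
      simpl (pred (S n)).
      rewrite !Cpow_S. field. split. apply fact_C_neq_0.
      intros H. apply RtoC_inj in H. revert H. apply not_0_INR. lia.
Qed.

(** The bound stays geometric with ratio [rho >= |h| / |s|] up to the full radius
    of convergence, since [|h| (1 - t) <= rho |s - t h|] for [t] in [[0,1]].  The
    Lagrange form of the remainder would only reach a smaller disc. *)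
Lemma binomial_remainder N (s h : C) (rho Q : R) n :
  (forall t, 0 <= t <= 1 -> slit (s - t * h)%C) ->
  0 <= rho <= 1 -> Cmod h <= rho * Cmod s ->
  (forall t, 0 <= t <= 1 -> Cmod (rsqrtC (s - t * h)%C) <= Q) ->
  Cmod (rsqrtC (s - h) ^ N
     - @sum_n C_AbelianGroup (fun k => pochhammer (RtoC (INR N / 2)) k / RtoC (INR (fact k))
          * h ^ k * rsqrtC s ^ (N + 2 * k))%C n)%C
  <= Cmod (pochhammer (RtoC (INR N / 2)) (S n)) / INR (fact n) * Cmod h * rho ^ n * Q ^ (N + 2).
Proof.
  intros Hs Hr Hh HQ.
  assert (E1 : moving_taylor N s h n 1 = (rsqrtC (s - h) ^ N)%C).
  { unfold moving_taylor. replace (s - RtoC 1 * h)%C with (s - h)%C by ring.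
    induction n as [|n IH].
    - rewrite sum_n_C_0. simpl pochhammer. simpl fact.
      rewrite Nat.mul_0_r, Nat.add_0_r. simpl INR. simpl (Cpow (h * _)%C 0). field.
    - rewrite sum_n_C_S, IH. rewrite Cpow_S, Rminus_diag. ring. }
  assert (E0 : moving_taylor N s h n 0 = @sum_n C_AbelianGroup (fun k => pochhammer (RtoC (INR N / 2)) k / RtoC (INR (fact k))
          * h ^ k * rsqrtC s ^ (N + 2 * k))%C n).
  { unfold moving_taylor. apply sum_n_ext. intros k.
    rewrite Rminus_0_r. replace (s - RtoC 0 * h)%C with s by ring.
    replace (h * RtoC 1)%C with h by ring. reflexivity. }
  rewrite <- E0, <- E1.
  eapply Rle_trans. apply (Cmod_mean_value _ _ 0 1) with (2 := fun t Ht => is_derive_moving_taylor N s h n t (Hs t Ht)).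
  lra. 2: rewrite Rminus_0_r, Rmult_1_r; apply Rle_refl.
  intros t Ht. cbv beta. pose proof (Hs t Ht) as S1. pose proof (rsqrtC_Cmod _ S1) as F.
  specialize (HQ t Ht). set (y := rsqrtC (s - t * h)%C) in *.
  pose proof (Cmod_ge_0 y) as Y0. pose proof (Cmod_ge_0 h) as H0.
  replace (N + 2 * n + 2)%nat with (2 * n + (N + 2))%nat by lia.
  rewrite Cpow_add_r, Cpow_mult_r.
  match goal with |- Cmod ?z <= _ => replace z with
   (pochhammer (RtoC (INR N / 2)) (S n) * / INR (fact n) * h * (h * RtoC (1 - t) * y ^ 2) ^ n * y ^ (N + 2))%C end.
  2:{ rewrite (Cpow_mult_l (h * RtoC (1 - t))). unfold Cdiv. ring. }
  rewrite !Cmod_mult, !Cmod_pow, !Cmod_mult.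
  rewrite Cmod_inv by apply fact_C_neq_0. rewrite Cmod_R, (Rabs_pos_eq (INR _)) by apply pos_INR.
  assert (0 <= / INR (fact n)) by (apply Rlt_le, Rinv_0_lt_compat, INR_fact_lt_0).
  apply Rmult_le_compat.
  - repeat apply Rmult_le_pos; try apply Cmod_ge_0; auto.
    apply pow_le. repeat apply Rmult_le_pos; try apply Cmod_ge_0.
  - now apply pow_le.
  - apply Rmult_le_compat_l.
    repeat apply Rmult_le_pos; try apply Cmod_ge_0; auto.
    apply pow_incr. split. repeat apply Rmult_le_pos; try apply Cmod_ge_0.
    rewrite Cmod_pow, Cmod_R, Rabs_pos_eq by lra.
    assert (T : Cmod s <= Cmod (s - t * h)%C + t * Cmod h).
    { pose proof (Cmod_triangle (s - t * h)%C (t * h)%C) as T.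
      rewrite Cmod_mult, Cmod_R, (Rabs_pos_eq t) in T by lra.
      replace (s - t * h + t * h)%C with s in T by ring. exact T. }
    apply Rmult_le_reg_r with (1 := slit_Cmod _ S1).
    rewrite Rmult_assoc, F, Rmult_1_r.
    assert (T2 := Rmult_le_compat_l rho _ _ (proj1 Hr) T).
    assert (T3 : 0 <= (1 - rho) * (t * Cmod h)) by (apply Rmult_le_pos; [lra | apply Rmult_le_pos; lra]).
    lra.
  - apply pow_incr. lra.
Qed.

(** * Complex power series *)

Lemma is_pseries_C_iff (a : nat -> C) (x l : C) :
  @is_pseries C_AbsRing C_NormedModule a x l <->
  (forall eps : posreal, eventually (fun n =>
     Cmod (@sum_n C_AbelianGroup (fun k => a k * x ^ k)%C n - l)%C < eps)).
Proof.
  assert (E : forall n, @sum_n C_AbelianGroup (fun k => a k * x ^ k)%C n =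
     sum_n (fun k => @scal C_AbsRing C_NormedModule (@pow_n C_AbsRing x k) (a k)) n).
  { intros n. apply sum_n_ext. intros k. as_C_equation.
    assert (H : @pow_n C_AbsRing x k = (x ^ k)%C).
    { induction k as [|k IH]; [reflexivity|]. simpl. rewrite IH. reflexivity. }
    rewrite H. change (scal ?p ?q) with (p * q)%C. ring. }
  unfold is_pseries, is_series.
  rewrite (filterlim_locally_ball_norm (U := C_NormedModule) (K := C_AbsRing)).
  split; intros H eps; specialize (H eps); revert H; apply filter_imp; intros n Hn;
    [rewrite E | rewrite E in Hn]; exact Hn.
Qed.

Lemma is_lim_seq_ratio_lt_1 (a : nat -> R) (q : R) :
  0 <= q < 1 -> (forall n, 0 <= a n) ->
  eventually (fun n => a (S n) <= q * a n) -> is_lim_seq a 0.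
Proof.
  intros Hq Ha [n0 Hn].
  apply (is_lim_seq_incr_n a n0).
  apply is_lim_seq_le_le with (fun _ => 0) (fun n => a n0 * q ^ n).
  - intros n. split. apply Ha. induction n as [|n IH].
    + simpl. lra.
    + simpl. eapply Rle_trans. apply Hn. lia.
      replace (a n0 * (q * q ^ n)) with (q * (a n0 * q ^ n)) by ring.
      apply Rmult_le_compat_l; lra.
  - apply is_lim_seq_const.
  - evar_last. apply is_lim_seq_scal_l. apply is_lim_seq_geom. rewrite Rabs_pos_eq; lra.
    simpl. f_equal. ring.
Qed.

(** The ratio of consecutive terms is [rho |x + n + 1| / (n + 1)], which tends to
    [rho] and is at most [(1 + rho) / 2] once [2 |x| <= (n + 1) (1 - rho)]. *)
Lemma pochhammer_growth (x : C) (rho : R) : 0 <= rho < 1 ->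
  is_lim_seq (fun n => Cmod (pochhammer x (S n)) / INR (fact n) * rho ^ n) 0.
Proof.
  intros Hr.
  apply is_lim_seq_ratio_lt_1 with ((1 + rho) / 2).
  - lra.
  - intros n. apply Rmult_le_pos; [|now apply pow_le].
    apply Rmult_le_pos. apply Cmod_ge_0. apply Rlt_le, Rinv_0_lt_compat, INR_fact_lt_0.
  - destruct (nfloor_ex (2 * Cmod x / (1 - rho))) as [n0 Hn0].
    { apply Rmult_le_pos. pose proof (Cmod_ge_0 x); lra. apply Rlt_le, Rinv_0_lt_compat; lra. }
    exists (S n0). intros n Hn.
    assert (H1 : 2 * Cmod x <= INR (S n) * (1 - rho)).
    { apply Rmult_le_reg_r with (/ (1 - rho)). apply Rinv_0_lt_compat; lra.
      rewrite (Rmult_assoc (INR (S n))), Rinv_r, Rmult_1_r by lra.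
      apply Rlt_le, Rlt_le_trans with (1 := proj2 Hn0). rewrite <- S_INR. apply le_INR. lia. }
    change (pochhammer x (S (S n))) with (pochhammer x (S n) * (x + RtoC (INR (S n))))%C.
    rewrite Cmod_mult. change (fact (S n)) with (S n * fact n)%nat. rewrite mult_INR.
    assert (P : 0 < INR (S n)) by (apply lt_0_INR; lia).
    pose proof (INR_fact_lt_0 n) as F.
    pose proof (Cmod_ge_0 (pochhammer x (S n))) as P0.
    assert (H2 : Cmod (x + INR (S n))%C <= Cmod x + INR (S n)).
    { eapply Rle_trans. apply Cmod_triangle. rewrite Cmod_R, (Rabs_pos_eq (INR _)); lra. }
    assert (H3 : Cmod (x + INR (S n))%C * rho <= (1 + rho) / 2 * INR (S n)).
    { apply Rle_trans with ((Cmod x + INR (S n)) * rho).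
      apply Rmult_le_compat_r; lra. pose proof (Cmod_ge_0 x). nra. }
    rewrite <- tech_pow_Rmult.
    replace (Cmod (pochhammer x (S n)) * Cmod (x + INR (S n))%C / (INR (S n) * INR (fact n)) * (rho * rho ^ n))
      with (Cmod (x + INR (S n))%C * rho * (Cmod (pochhammer x (S n)) / INR (fact n) * rho ^ n / INR (S n))) by (field; lra).
    replace ((1 + rho) / 2 * (Cmod (pochhammer x (S n)) / INR (fact n) * rho ^ n))
      with ((1 + rho) / 2 * INR (S n) * (Cmod (pochhammer x (S n)) / INR (fact n) * rho ^ n / INR (S n))) by (field; lra).
    apply Rmult_le_compat_r; [|exact H3].
    repeat apply Rmult_le_pos; try lra; try (apply Rlt_le, Rinv_0_lt_compat; lra).
    apply pow_le; lra.
Qed.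

(** * Euler's integral *)

Definition euler_integrand (p q N : nat) (u : C) (t : R) : C :=
  (RtoC (t ^ p * (1 - t) ^ q) * rsqrtC (1 - RtoC t * u) ^ N)%C.

Definition euler_integral (p q N : nat) (u : C) : C :=
  RInt (V := C_R_CompleteNormedModule) (euler_integrand p q N u) 0 1.

(** The values [1 - t u], with [t] in [[0,1]], avoid the nonpositive reals exactly
    because [u] avoids the reals [x >= 1]. *)
Lemma cut_plane_slit (u : C) (t : R) : cut_plane u -> 0 <= t <= 1 -> slit (1 - t * u)%C.
Proof.
  intros Hu Ht. unfold slit.
  destruct (Rlt_or_le 0 (Cmod (1 - t * u)%C + Re (1 - t * u)%C)) as [H|H]; [exact H|].
  exfalso. apply Hu. destruct u as [x y].
  pose proof (Cmod2_alt (1 - t * (x, y))%C) as E.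
  assert (R1 : Re (1 - t * (x, y))%C = 1 - t * x) by (simpl; ring).
  assert (I1 : Im (1 - t * (x, y))%C = - (t * y)) by (simpl; ring).
  rewrite R1 in *. rewrite I1 in *.
  pose proof (Cmod_ge_0 (1 - t * (x, y))%C) as M.
  assert (H1 : Cmod (1 - t * (x, y))%C ^ 2 <= (1 - t * x) ^ 2) by nra.
  assert (H2 : t * y = 0).
  { apply Rsqr_0_uniq. apply Rle_antisym; [unfold Rsqr; nra | apply Rle_0_sqr]. }
  assert (H3 : 1 <= t * x) by lra.
  exists x. split.
  { destruct (Rle_lt_dec 1 x) as [L|L]; [exact L|]. assert (t = 1) by nra. subst t. lra. }
  unfold RtoC. f_equal. destruct (Rmult_integral _ _ H2); nra.
Qed.

Lemma ex_derive_euler_integrand p q N u t : cut_plane u -> 0 <= t <= 1 ->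
  ex_derive (V := C_R_NormedModule) (euler_integrand p q N u) t.
Proof.
  intros Hu Ht. eexists. apply is_derive_Cmult.
  apply is_derive_RtoC. auto_derive. exact I. reflexivity.
  apply rsqrtC_line_pow_derive. now apply cut_plane_slit.
Qed.

Lemma is_RInt_euler_integral p q N u : cut_plane u ->
  is_RInt (V := C_R_NormedModule) (euler_integrand p q N u) 0 1 (euler_integral p q N u).
Proof.
  intros Hu. apply (RInt_correct (V := C_R_CompleteNormedModule)).
  apply (ex_RInt_continuous (V := C_R_CompleteNormedModule)).
  rewrite Rmin_left, Rmax_right by lra. intros t Ht.
  apply (ex_derive_continuous (V := C_R_NormedModule)).
  now apply ex_derive_euler_integrand.
Qed.

Lemma is_RInt_Cmult (c : C) (f : R -> C) (a b : R) (l : C) :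
  is_RInt (V := C_R_NormedModule) f a b l ->
  is_RInt (V := C_R_NormedModule) (fun t => c * f t)%C a b (c * l)%C.
Proof.
  intros H.
  assert (H1 := is_RInt_fct_extend_fst (U := R_NormedModule) (V := R_NormedModule) _ _ _ _ H).
  assert (H2 := is_RInt_fct_extend_snd (U := R_NormedModule) (V := R_NormedModule) _ _ _ _ H).
  apply (is_RInt_fct_extend_pair (U := R_NormedModule) (V := R_NormedModule)).
  - apply is_RInt_ext with (fun t => minus (scal (fst c) (fst (f t))) (scal (snd c) (snd (f t)))).
    intros; reflexivity.
    apply (is_RInt_minus (V := R_NormedModule)); apply (is_RInt_scal (V := R_NormedModule)); assumption.
  - apply is_RInt_ext with (fun t => plus (scal (fst c) (snd (f t))) (scal (snd c) (fst (f t)))).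
    intros; reflexivity.
    apply (is_RInt_plus (V := R_NormedModule)); apply (is_RInt_scal (V := R_NormedModule)); assumption.
Qed.

(** Compactness of [[0,1]]. The number [d] is a radius of convergence of the Taylor
    series of Euler's integral at [z]. *)
Lemma cut_plane_distance (z : C) : cut_plane z ->
  exists d : R, 0 < d /\ forall t, 0 <= t <= 1 -> d <= Cmod (1 - t * z)%C.
Proof.
  intros Hz.
  destruct (continuity_ab_min (fun t => (1 - t * fst z) ^ 2 + (t * snd z) ^ 2) 0 1) as [t0 [H0 Ht0]].
  - lra.
  - intros t _. reg.
  - assert (E : forall t : R, Cmod (1 - t * z)%C = sqrt ((1 - t * fst z) ^ 2 + (t * snd z) ^ 2)).
    { intros t. unfold Cmod. f_equal. simpl. ring. }
    exists (Cmod (1 - t0 * z)%C). split.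
    apply slit_Cmod. now apply cut_plane_slit.
    intros t Ht. rewrite !E. apply sqrt_le_1_alt. now apply H0.
Qed.

(** A point [x >= 1] of the cut is the zero of [1 - t w] for [t = 1 / x], hence
    [d <= |1 - z / x| = |x - z| / x <= |x - z|]. *)
Lemma cut_plane_ball (z w : C) (d : R) :
  (forall t, 0 <= t <= 1 -> d <= Cmod (1 - t * z)%C) -> Cmod (w - z)%C < d -> cut_plane w.
Proof.
  intros Hd Hw [x [Hx ->]].
  assert (Hi : 0 < / x <= 1).
  { split. apply Rinv_0_lt_compat; lra. rewrite <- Rinv_1. apply Rinv_le_contravar; lra. }
  specialize (Hd (/ x) ltac:(lra)).
  replace (1 - RtoC (/ x) * z)%C with (RtoC (/ x) * (RtoC x - z))%C in Hd.
  2:{ rewrite RtoC_inv by lra. field. intros H. apply RtoC_inj in H. lra. }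
  rewrite Cmod_mult, Cmod_R, Rabs_pos_eq in Hd by lra.
  pose proof (Cmod_ge_0 (x - z)%C). nra.
Qed.

Lemma cut_plane_0_distance t : 0 <= t <= 1 -> 1 <= Cmod (1 - t * 0)%C.
Proof.
  intros _. replace (1 - t * 0)%C with (RtoC 1) by ring. rewrite Cmod_1. lra.
Qed.

(** The Taylor coefficients of Euler's integral at [z], from differentiation under
    the integral sign. *)
Definition euler_coef (p q N : nat) (z : C) (k : nat) : C :=
  (pochhammer (RtoC (INR N / 2)) k / RtoC (INR (fact k)) * euler_integral (p + k) q (N + 2 * k) z)%C.

(** Integrating the remainder of the binomial series for [s = 1 - t z] and
    [h = t (u - z)], whose bound is uniform in [t], needs no interchange of limit
    and integral: the partial sums are integrated exactly.  The number [Q] bounds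
    the inverse square roots along all the segments, as [y <= 1 + y^2] and
    [|y|^2 = 1 / |w| <= 1 / ((1 - rho) d)]. *)
Lemma euler_integral_remainder p q N (z u : C) (d rho Q : R) n :
  0 < d -> (forall t, 0 <= t <= 1 -> d <= Cmod (1 - t * z)%C) -> cut_plane z ->
  rho < 1 -> Cmod (u - z)%C <= rho * d -> 1 + / ((1 - rho) * d) <= Q ->
  Cmod (euler_integral p q N u
     - @sum_n C_AbelianGroup (fun k => euler_coef p q N z k * (u - z) ^ k)%C n)%C
  <= Cmod (pochhammer (RtoC (INR N / 2)) (S n)) / INR (fact n) * rho ^ n * (Cmod (u - z)%C * Q ^ (N + 2)).
Proof.
  intros Hd Hz Cz Hr Hu HQ.
  assert (Hr0 : 0 <= rho).
  { pose proof (Cmod_ge_0 (u - z)%C). apply Rmult_le_reg_r with d; lra. }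
  assert (Hball : forall w, Cmod (w - z)%C <= Cmod (u - z)%C -> cut_plane w).
  { intros w Hw. apply (cut_plane_ball z w d Hz). nra. }
  set (B := Cmod (pochhammer (RtoC (INR N / 2)) (S n)) / INR (fact n) * Cmod (u - z)%C * rho ^ n * Q ^ (N + 2)).
  replace (Cmod (pochhammer (RtoC (INR N / 2)) (S n)) / INR (fact n) * rho ^ n * (Cmod (u - z)%C * Q ^ (N + 2)))
   with (scal (1 - 0) B) by (transitivity ((1 - 0) * B : R); [reflexivity | unfold B; match goal with |- ?a = ?b => change (@eq R a b) end; ring]).
  assert (IT : is_RInt (V := C_R_NormedModule) (fun t : R => RtoC (t ^ p * (1 - t) ^ q) *
      @sum_n C_AbelianGroup (fun k => pochhammer (RtoC (INR N / 2)) k / RtoC (INR (fact k))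
          * (t * (u - z)) ^ k * rsqrtC (1 - t * z) ^ (N + 2 * k))%C n)%C 0 1
       (@sum_n C_AbelianGroup (fun k => euler_coef p q N z k * (u - z) ^ k)%C n)).
  { assert (Hk : forall k, is_RInt (V := C_R_NormedModule) (fun t : R => RtoC (t ^ p * (1 - t) ^ q) *
       (pochhammer (RtoC (INR N / 2)) k / RtoC (INR (fact k))
          * (t * (u - z)) ^ k * rsqrtC (1 - t * z) ^ (N + 2 * k)))%C 0 1 (euler_coef p q N z k * (u - z) ^ k)%C).
    { intros k.
      replace (euler_coef p q N z k * (u - z) ^ k)%C with
       (pochhammer (RtoC (INR N / 2)) k / RtoC (INR (fact k)) * (u - z) ^ k * euler_integral (p + k) q (N + 2 * k) z)%C
       by (unfold euler_coef; ring).
      eapply is_RInt_ext; [|apply is_RInt_Cmult; apply is_RInt_euler_integral, Cz].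
      intros t _. as_C_equation. unfold euler_integrand.
      rewrite Cpow_mult_l, !RtoC_mult, Rdef_pow_add, RtoC_mult, !RtoC_pow. ring. }
    clear B. induction n as [|n IH].
    - rewrite sum_n_C_0. eapply is_RInt_ext; [|apply (Hk O)].
      intros t _. as_C_equation. cbv beta. rewrite sum_n_C_0. reflexivity.
    - rewrite sum_n_C_S. eapply is_RInt_ext; [|apply (is_RInt_plus (V := C_R_NormedModule)); [exact IH | apply (Hk (S n))]].
      intros t _. as_C_equation. cbv beta. rewrite sum_n_C_S. change (@plus ?T ?a ?b) with (a + b)%C. ring. }
  assert (IU : is_RInt (V := C_R_NormedModule) (euler_integrand p q N u) 0 1 (euler_integral p q N u)).
  { apply is_RInt_euler_integral. apply Hball. lra. }
  rewrite Cmod_norm.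
  refine (norm_RInt_le (V := C_R_NormedModule) _ (fun _ => B) 0 1 _ _ Rle_0_1 _
    (is_RInt_minus (V := C_R_NormedModule) _ _ _ _ _ _ IU IT) (is_RInt_const (V := R_NormedModule) 0 1 B)).
  intros t Ht. rewrite <- Cmod_norm.
  match goal with |- Cmod ?v <= _ => replace v with
   (RtoC (t ^ p * (1 - t) ^ q) * (rsqrtC ((1 - t * z) - t * (u - z)) ^ N -
      @sum_n C_AbelianGroup (fun k => pochhammer (RtoC (INR N / 2)) k / RtoC (INR (fact k))
          * (t * (u - z)) ^ k * rsqrtC (1 - t * z) ^ (N + 2 * k))%C n))%C end.
  2:{ as_C_equation. unfold euler_integrand. change (@minus ?T ?a ?b) with (a - b)%C. cbv beta.
      replace (1 - t * z - t * (u - z))%C with (1 - t * u)%C by ring. ring. }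
  rewrite Cmod_mult, Cmod_R.
  assert (W : Rabs (t ^ p * (1 - t) ^ q) <= 1).
  { rewrite Rabs_mult, <- !RPow_abs, !Rabs_pos_eq by lra.
    pose proof (pow_incr t 1 p ltac:(lra)) as W1. pose proof (pow_incr (1 - t) 1 q ltac:(lra)) as W2.
    rewrite pow1 in W1, W2. apply Rle_trans with (1 * 1); [|lra].
    apply Rmult_le_compat; try assumption; apply pow_le; lra. }
  assert (Hseg : forall w, 0 <= w <= 1 -> slit (1 - t * z - w * (t * (u - z)))%C).
  { intros w Hw. replace (1 - t * z - w * (t * (u - z)))%C with (1 - t * (z + w * (u - z)))%C by ring.
    apply cut_plane_slit; [|exact Ht]. apply Hball.
    replace (z + w * (u - z) - z)%C with (w * (u - z))%C by ring.
    rewrite Cmod_mult, Cmod_R, Rabs_pos_eq by lra. pose proof (Cmod_ge_0 (u - z)%C). nra. }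
  assert (Ht2 : Cmod (t * (u - z))%C <= Cmod (u - z)%C).
  { rewrite Cmod_mult, Cmod_R, Rabs_pos_eq by lra. pose proof (Cmod_ge_0 (u - z)%C). nra. }
  specialize (Hz t Ht).
  assert (Q0 : 0 < / ((1 - rho) * d)) by (apply Rinv_0_lt_compat, Rmult_lt_0_compat; lra).
  assert (R := binomial_remainder N (1 - t * z)%C (t * (u - z))%C rho Q n Hseg).
  rewrite <- (Rmult_1_l B). apply Rmult_le_compat; [apply Rabs_pos | apply Cmod_ge_0 | exact W |].
  eapply Rle_trans. apply R.
  - lra.
  - eapply Rle_trans. exact Ht2. eapply Rle_trans. exact Hu. apply Rmult_le_compat_l; lra.
  - intros w Hw. specialize (Hseg w Hw). pose proof (rsqrtC_Cmod _ Hseg) as F.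
    set (y := rsqrtC (1 - t * z - w * (t * (u - z)))%C) in *. pose proof (Cmod_ge_0 y) as Y.
    assert (L : (1 - rho) * d <= Cmod (1 - t * z - w * (t * (u - z)))%C).
    { pose proof (Cmod_triangle (1 - t * z - w * (t * (u - z)))%C (w * (t * (u - z)))%C) as T1.
      replace (1 - t * z - w * (t * (u - z)) + w * (t * (u - z)))%C with (1 - t * z)%C in T1 by ring.
      rewrite (Cmod_mult w), Cmod_R, (Rabs_pos_eq w) in T1 by lra.
      pose proof (Cmod_ge_0 (t * (u - z))%C). nra. }
    assert (L2 : Cmod y ^ 2 <= / ((1 - rho) * d)).
    { apply Rmult_le_reg_r with (1 := slit_Cmod _ Hseg). rewrite F.
      apply Rmult_le_reg_l with ((1 - rho) * d). apply Rmult_lt_0_compat; lra.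
      rewrite <- Rmult_assoc, Rinv_r by (apply Rgt_not_eq, Rmult_lt_0_compat; lra). lra. }
    nra.
  - unfold B. apply Rmult_le_compat_r. apply pow_le; lra.
    apply Rmult_le_compat_r. now apply pow_le. apply Rmult_le_compat_l; [|exact Ht2].
    apply Rmult_le_pos. apply Cmod_ge_0. apply Rlt_le, Rinv_0_lt_compat, INR_fact_lt_0.
Qed.

Lemma euler_integral_pseries p q N (z u : C) (d : R) :
  0 < d -> (forall t, 0 <= t <= 1 -> d <= Cmod (1 - t * z)%C) -> Cmod (u - z)%C < d ->
  @is_pseries C_AbsRing C_NormedModule (euler_coef p q N z) (u - z)%C (euler_integral p q N u).
Proof.
  intros Hd Hz Hu.
  assert (Cz : cut_plane z).
  { apply (cut_plane_ball z z d Hz). replace (z - z)%C with (RtoC 0) by ring. now rewrite Cmod_0. }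
  set (rho := Cmod (u - z)%C / d).
  assert (Hr : 0 <= rho < 1).
  { split. apply Rmult_le_pos. apply Cmod_ge_0. now apply Rlt_le, Rinv_0_lt_compat.
    apply Rmult_lt_reg_r with (1 := Hd). unfold rho. field_simplify; lra. }
  set (Q := 1 + / ((1 - rho) * d)).
  apply is_pseries_C_iff. intros eps.
  assert (L := is_lim_seq_scal_r _ (Cmod (u - z)%C * Q ^ (N + 2)) _ (pochhammer_growth (RtoC (INR N / 2)) rho Hr)).
  simpl in L. rewrite Rmult_0_l in L.
  apply is_lim_seq_spec in L. specialize (L eps). revert L. apply filter_imp. intros n Hn.
  rewrite <- Cmod_opp, Copp_minus_distr.
  eapply Rle_lt_trans. apply (euler_integral_remainder p q N z u d rho Q n); try assumption.
  apply Hr. unfold rho. apply Req_le. field. lra. apply Rle_refl.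
  rewrite Rminus_0_r in Hn. eapply Rle_lt_trans. apply Rle_abs. exact Hn.
Qed.

(** The remainder of order one on the disc of radius [d / 2], where [rho <= 1/2]. *)
Lemma is_derive_euler_integral p q N (z : C) : cut_plane z ->
  @is_derive C_AbsRing C_NormedModule (euler_integral p q N) z
   (RtoC (INR N / 2) * euler_integral (p + 1) q (N + 2) z)%C.
Proof.
  intros Cz. destruct (cut_plane_distance z Cz) as [d [Hd Hz]].
  set (Q := 1 + / ((1 - / 2) * d)).
  apply (@is_derive_quadratic C_AbsRing C_NormedModule) with
    (Cmod (pochhammer (RtoC (INR N / 2)) 2) / d * Q ^ (N + 2)).
  assert (Hd2 : 0 < d / 2) by lra.
  exists (mkposreal _ Hd2). intros u Hu. change (Cmod (u - z)%C < d / 2) in Hu.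
  change (@norm _ _ ?z) with (Cmod z). change (abs ?z) with (Cmod z).
  change (@minus _ u z) with (u - z)%C.
  assert (Hr : Cmod (u - z)%C / d <= / 2).
  { apply Rmult_le_reg_r with (1 := Hd). unfold Rdiv. rewrite Rmult_assoc, Rinv_l; lra. }
  assert (R := euler_integral_remainder p q N z u d (Cmod (u - z)%C / d) Q 1 Hd Hz Cz).
  rewrite sum_n_C_S, sum_n_C_0 in R.
  match goal with |- Cmod ?a <= _ => match type of R with _ -> _ -> _ -> Cmod ?b <= _ => replace a with b end end.
  eapply Rle_trans. apply R. lra. apply Req_le. field. lra.
  - unfold Q. apply Rplus_le_compat_l. apply Rinv_le_contravar.
    apply Rmult_lt_0_compat; lra. apply Rmult_le_compat_r; lra.
  - simpl (fact 1). simpl INR. apply Req_le. field. lra.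
  - unfold euler_coef. simpl pochhammer. simpl fact. rewrite !Nat.add_0_r. simpl (2 * 1)%nat.
    change (scal ?a ?b) with (a * b)%C. do 2 change (@minus _ ?a ?b) with (a - b)%C.
    simpl INR. simpl Cpow. field.
Qed.

(** * Relations between Euler integrals *)

(** The integrands satisfy it pointwise: multiply [w^(-1) = 1 + u t w^(-1)], where
    [w = 1 - t u], by [t^p (1-t)^q w^(-N/2)]. *)
Lemma euler_integral_contiguous p q N u : cut_plane u ->
  euler_integral p q (N + 2) u
  = (euler_integral p q N u + u * euler_integral (p + 1) q (N + 2) u)%C.
Proof.
  intros Hu. apply (is_RInt_unique (V := C_R_CompleteNormedModule)).
  eapply is_RInt_ext; [|apply (is_RInt_plus (V := C_R_NormedModule));
    [|apply is_RInt_Cmult]; apply is_RInt_euler_integral, Hu].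
  rewrite Rmin_left, Rmax_right by lra. intros t Ht. as_C_equation.
  change (@plus ?T ?a ?b) with (a + b)%C. unfold euler_integrand.
  assert (S := rsqrtC_sqr _ (cut_plane_slit u t Hu ltac:(lra))).
  rewrite pow_add, !Cpow_add_r, !RtoC_mult, pow_1.
  set (x := rsqrtC (1 - t * u)%C) in *.
  transitivity (t ^ p * (1 - t) ^ q * x ^ N * (x ^ 2 * (1 - t * u)) + u * (t ^ p * t * (1 - t) ^ q * (x ^ N * x ^ 2)))%C.
  rewrite S, !RtoC_pow, RtoC_minus. ring.
  rewrite !RtoC_pow, RtoC_minus. ring.
Qed.

(** The integral over [[0,1]] of the derivative of
    [t^(p+1) (1-t)^(q+1) (1 - t u)^(-N/2)], which vanishes at both ends. *)
Lemma euler_integral_by_parts p q N u : cut_plane u ->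
  (RtoC (INR (S q)) * euler_integral (S p) q N u
   = RtoC (INR (S p)) * euler_integral p (S q) N u
     + RtoC (INR N / 2) * u * euler_integral (S p) (S q) (N + 2) u)%C.
Proof.
  intros Hu.
  set (df := fun t : R => (RtoC (INR (S p)) * euler_integrand p (S q) N u t
     + RtoC (INR N / 2) * u * euler_integrand (S p) (S q) (N + 2) u t
     + (- RtoC (INR (S q))) * euler_integrand (S p) q N u t)%C).
  assert (H1 : is_RInt (V := C_R_NormedModule) df 0 1 (RtoC (INR (S p)) * euler_integral p (S q) N u
     + RtoC (INR N / 2) * u * euler_integral (S p) (S q) (N + 2) u
     + (- RtoC (INR (S q))) * euler_integral (S p) q N u)%C).
  { unfold df.
    apply (is_RInt_plus (V := C_R_NormedModule)). apply (is_RInt_plus (V := C_R_NormedModule)).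
    all: apply is_RInt_Cmult, is_RInt_euler_integral, Hu. }
  assert (H2 : is_RInt (V := C_R_NormedModule) df 0 1
     (minus (G := C_R_NormedModule) (euler_integrand (S p) (S q) N u 1) (euler_integrand (S p) (S q) N u 0))).
  { apply (is_RInt_derive (V := C_R_CompleteNormedModule)); rewrite Rmin_left, Rmax_right by lra; intros t Ht.
    - evar_last. apply is_derive_Cmult.
      apply is_derive_RtoC. apply (is_derive_mult (K := R_AbsRing)).
      auto_derive. exact I. reflexivity. auto_derive. exact I. reflexivity. intros; apply Rmult_comm.
      apply rsqrtC_line_pow_derive. now apply cut_plane_slit.
      as_C_equation. unfold df, euler_integrand.
      change (@plus ?T ?a ?b) with (a + b)%R. change (@mult ?T ?a ?b) with (a * b)%R.
      change (match p with O => 1 | S _ => INR p + 1 end) with (INR (S p)).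
      change (match q with O => 1 | S _ => INR q + 1 end) with (INR (S q)).
      change (1 + - t) with (1 - t).
      rewrite !RtoC_plus, !RtoC_mult. simpl pred. rewrite <- !tech_pow_Rmult, !RtoC_mult.
      rewrite RtoC_opp. ring.
    - apply (ex_derive_continuous (V := C_R_NormedModule)).
      destruct (ex_derive_euler_integrand p (S q) N u t Hu Ht) as [l1 D1].
      destruct (ex_derive_euler_integrand (S p) (S q) (N + 2) u t Hu Ht) as [l2 D2].
      destruct (ex_derive_euler_integrand (S p) q N u t Hu Ht) as [l3 D3].
      unfold df. eexists.
      apply (is_derive_plus (V := C_R_NormedModule)). apply (is_derive_plus (V := C_R_NormedModule)).
      all: apply is_derive_Cmult; [apply is_derive_Cconst|eassumption]. }
  assert (E := eq_trans (eq_sym (is_RInt_unique (V := C_R_CompleteNormedModule) _ _ _ _ H1))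
    (is_RInt_unique (V := C_R_CompleteNormedModule) _ _ _ _ H2)).
  change (@minus ?T ?a ?b) with (a - b)%C in E.
  unfold euler_integrand in E at 1 2. rewrite Rminus_diag, !pow_ne_zero, Rmult_0_r, Rmult_0_l in E by lia.
  apply Ceq_minus. rewrite <- Copp_0.
  replace (RtoC 0) with (0 * rsqrtC (1 - 1 * u) ^ N - 0 * rsqrtC (1 - 0 * u) ^ N)%C by ring.
  rewrite <- E. ring.
Qed.

(** At [u = 0] the integration by parts is the recursion in [q] of the Beta
    integral. *)
Lemma euler_integral_0 p q N :
  euler_integral p q N 0 = RtoC (INR (fact p) * INR (fact q) / INR (fact (p + q + 1))).
Proof.
  assert (C0 : cut_plane 0).
  { intros [x [Hx E]]. apply RtoC_inj in E. lra. }
  revert p. induction q as [|q IH]; intros p.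
  - apply (is_RInt_unique (V := C_R_CompleteNormedModule)).
    replace (RtoC (INR (fact p) * INR (fact 0) / INR (fact (p + 0 + 1)))) with
      (minus (G := C_R_NormedModule) (RtoC (1 ^ S p / INR (S p))) (RtoC (0 ^ S p / INR (S p)))).
    2:{ as_C_equation. change (@minus ?T ?a ?b) with (a - b)%C. rewrite <- RtoC_minus. f_equal.
        rewrite pow1, pow_ne_zero by lia. rewrite Nat.add_0_r, Nat.add_1_r.
        change (fact (S p)) with (S p * fact p)%nat. rewrite mult_INR.
        simpl (fact 0). simpl (INR 1). field. split. apply INR_fact_neq_0. apply not_0_INR; lia. }
    apply is_RInt_ext with (fun t : R => RtoC (t ^ p)).
    { intros t _. as_C_equation. unfold euler_integrand. replace (1 - t * 0)%C with (RtoC 1) by ring.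
      rewrite rsqrtC_1, Cpow_1_l. rewrite pow_O, Rmult_1_r. ring. }
    apply (is_RInt_derive (V := C_R_CompleteNormedModule) (fun t : R => RtoC (t ^ S p / INR (S p)))); intros t _.
    + apply is_derive_RtoC. auto_derive. exact I. simpl pred.
      change (match p with O => 1 | S _ => INR p + 1 end) with (INR (S p)). field. apply not_0_INR; lia.
    + apply (ex_derive_continuous (V := C_R_NormedModule)). eexists.
      apply is_derive_RtoC. auto_derive. exact I. reflexivity.
  - assert (E := euler_integral_by_parts p q N 0 C0).
    rewrite IH in E.
    assert (P : RtoC (INR (S p)) <> 0).
    { intros H. apply RtoC_inj in H. revert H. apply not_0_INR; lia. }
    replace (euler_integral p (S q) N 0) with
      (/ RtoC (INR (S p)) * (RtoC (INR (S p)) * euler_integral p (S q) N 0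
        + RtoC (INR N / 2) * 0 * euler_integral (S p) (S q) (N + 2) 0))%C by (field; exact P).
    rewrite <- E, <- RtoC_inv, <- !RtoC_mult by (apply not_0_INR; lia). f_equal.
    replace (S p + q + 1)%nat with (p + S q + 1)%nat by lia.
    change (fact (S p)) with (S p * fact p)%nat. change (fact (S q)) with (S q * fact q)%nat.
    rewrite !mult_INR. field. split. apply INR_fact_neq_0. apply not_0_INR; lia.
Qed.

Lemma pochhammer_INR n k :
  pochhammer (RtoC (INR (S n))) k = RtoC (INR (fact (n + k)) / INR (fact n)).
Proof.
  induction k as [|k IH].
  - rewrite Nat.add_0_r. simpl. f_equal. field. apply INR_fact_neq_0.
  - change (pochhammer (RtoC (INR (S n))) (S k))
      with (pochhammer (RtoC (INR (S n))) k * (RtoC (INR (S n)) + RtoC (INR k)))%C.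
    rewrite IH, <- RtoC_plus, <- RtoC_mult. f_equal.
    rewrite <- plus_INR. replace (n + S k)%nat with (S (n + k)) by lia.
    change (fact (S (n + k))) with (S (n + k) * fact (n + k))%nat. rewrite mult_INR.
    change (S n + k)%nat with (S (n + k)). field. apply INR_fact_neq_0.
Qed.

(** The Beta function [B (p+1, q+1)]. *)
Definition beta_factor (p q : nat) : R := INR (fact p) * INR (fact q) / INR (fact (p + q + 1)).

Lemma beta_factor_neq_0 p q : beta_factor p q <> 0.
Proof.
  unfold beta_factor. apply Rgt_not_eq, Rdiv_lt_0_compat; [apply Rmult_lt_0_compat|]; apply INR_fact_lt_0.
Qed.

(** The ratio of Beta values [B (p+k+1, q+1) / B (p+1, q+1)] is the ratio
    [(p+1)_k / (p+q+2)_k] of rising factorials. *)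
Lemma euler_coef_0 p q N k :
  euler_coef p q N 0 k = (RtoC (beta_factor p q)
    * hyp2F1_coef (RtoC (INR N / 2)) (RtoC (INR (p + 1))) (RtoC (INR (p + q + 2))) k)%C.
Proof.
  unfold euler_coef, hyp2F1_coef, beta_factor. rewrite euler_integral_0.
  replace (p + 1)%nat with (S p) by lia. replace (p + q + 2)%nat with (S (p + q + 1)) by lia.
  rewrite !pochhammer_INR. replace (p + k + q + 1)%nat with (p + q + 1 + k)%nat by lia.
  pose proof (fact_C_neq_0) as F. pose proof INR_fact_neq_0 as G.
  rewrite !RtoC_div by auto. rewrite !RtoC_mult.
  field. repeat split; apply F.
Qed.

(** * Uniqueness of analytic continuation in the cut plane *)

Lemma C_analytic_at_minus f g z :
  C_analytic_at f z -> C_analytic_at g z -> C_analytic_at (fun w => f w - g w)%C z.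
Proof.
  intros [a [r [Hr Ha]]] [b [s [Hs Hb]]].
  exists (fun k => a k - b k)%C, (Rmin r s). split. now apply Rmin_pos.
  intros w Hw.
  apply (is_pseries_minus (K := C_AbsRing) (V := C_NormedModule)).
  apply Ha. apply Rlt_le_trans with (1 := Hw), Rmin_l.
  apply Hb. apply Rlt_le_trans with (1 := Hw), Rmin_r.
Qed.

Lemma is_pseries_C_bounded (c : nat -> C) (x l : C) :
  @is_pseries C_AbsRing C_NormedModule c x l ->
  exists M, forall n, Cmod (c n * x ^ n)%C <= M.
Proof.
  intros H. apply is_pseries_C_iff with (eps := mkposreal 1 Rlt_0_1) in H.
  destruct H as [n0 Hn]. simpl in Hn.
  set (S := fun n => @sum_n C_AbelianGroup (fun k => c k * x ^ k)%C n) in *.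
  assert (B : exists M, forall n, (n <= n0)%nat -> Cmod (c n * x ^ n)%C <= M).
  { clear. induction n0 as [|n0 [M IH]].
    - exists (Cmod (c O * x ^ 0)%C). intros n Hn. replace n with O by lia. lra.
    - exists (Rmax M (Cmod (c (S n0) * x ^ (S n0))%C)). intros n Hn.
      destruct (Nat.eq_dec n (S n0)) as [->|D]. apply Rmax_r.
      eapply Rle_trans; [apply IH; lia | apply Rmax_l]. }
  destruct B as [M B]. exists (Rmax M 2). intros n.
  destruct (le_lt_dec n n0) as [L|L].
  - eapply Rle_trans; [now apply B | apply Rmax_l].
  - eapply Rle_trans; [|apply Rmax_r]. destruct n as [|n]; [lia|].
    replace (c (Datatypes.S n) * x ^ Datatypes.S n)%C with ((S (Datatypes.S n) - l) + - (S n - l))%C.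
    2:{ unfold S. rewrite sum_n_C_S. ring. }
    eapply Rle_trans. apply Cmod_triangle. rewrite Cmod_opp.
    pose proof (Hn (Datatypes.S n) ltac:(lia)). pose proof (Hn n ltac:(lia)). lra.
Qed.

(** If [c n] is the first nonzero coefficient, then
    [|h z - c n (z - z0)^n| <= K |z - z0|^(n+1)] near [z0]; at a zero [z <> z0]
    this gives [|c n| <= K |z - z0|], which is impossible for [z] close to [z0]. *)
Lemma analytic_zeros_isolated (c : nat -> C) (h : C -> C) (z0 : C) (r : R) :
  0 < r ->
  (forall z, Cmod (z - z0)%C < r -> @is_pseries C_AbsRing C_NormedModule c (z - z0)%C (h z)) ->
  (forall eps, 0 < eps -> exists z, 0 < Cmod (z - z0)%C < eps /\ h z = 0) ->
  forall z, Cmod (z - z0)%C < r -> h z = 0.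
Proof.
  intros Hr Hs Hz.
  assert (Hc : forall n, c n = 0).
  { intros n. induction n as [n IH] using (well_founded_induction lt_wf).
    set (r1 := r / 2).
    destruct (is_pseries_C_bounded c (RtoC r1) (h (z0 + r1)%C)) as [M HM].
    { replace (RtoC r1) with (z0 + r1 - z0)%C at 1 by ring. apply Hs.
      replace (z0 + r1 - z0)%C with (RtoC r1) by ring. rewrite Cmod_R, Rabs_pos_eq; unfold r1; lra. }
    assert (HM0 : 0 <= M) by (apply Rle_trans with (2 := HM O), Cmod_ge_0).
    assert (R1 : 0 < r1) by (unfold r1; lra).
    (* The coefficients are bounded by those of a geometric series of radius [r1];
       for [|w| <= r1 / 2] its tail after the term [n] sums to at most twice its
       first term. *)
    assert (T : forall w, Cmod w <= r1 / 2 -> forall j,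
       Cmod (@sum_n C_AbelianGroup (fun k => c k * w ^ k)%C (n + j) - c n * w ^ n)%C
        <= M * (Cmod w / r1) ^ S n * (2 - 2 * (/ 2) ^ j)).
    { intros w Hw. set (x := Cmod w / r1).
      assert (Hx : 0 <= x <= / 2).
      { unfold x. split. apply Rmult_le_pos. apply Cmod_ge_0. apply Rlt_le, Rinv_0_lt_compat, R1.
        apply Rmult_le_reg_r with (1 := R1). unfold Rdiv. rewrite Rmult_assoc, Rinv_l; lra. }
      induction j as [|j IHj].
      - rewrite Nat.add_0_r.
        replace (@sum_n C_AbelianGroup (fun k => c k * w ^ k)%C n) with (c n * w ^ n)%C.
        replace (c n * w ^ n - c n * w ^ n)%C with (RtoC 0) by ring. rewrite Cmod_0. simpl. lra.
        destruct n as [|n]. now rewrite sum_n_C_0.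
        rewrite sum_n_C_S.
        assert (Z : @eq C (@sum_n C_AbelianGroup (fun k => c k * w ^ k)%C n) 0).
        { assert (Zk : forall k, (k <= n)%nat -> @eq C (@sum_n C_AbelianGroup (fun k => c k * w ^ k)%C k) 0).
          { induction k as [|k IHk]; intros Hk. rewrite sum_n_C_0, IH by lia. ring.
            rewrite sum_n_C_S, IHk, IH by lia. ring. }
          now apply Zk. }
        rewrite Z. ring.
      - rewrite Nat.add_succ_r, sum_n_C_S.
        match goal with |- Cmod (?a + ?b - ?d)%C <= _ => replace (a + b - d)%C with ((a - d) + b)%C by ring end.
        eapply Rle_trans. apply Cmod_triangle.
        assert (B : Cmod (c (S (n + j)) * w ^ S (n + j))%C <= M * x ^ S n * (/ 2) ^ j).
        { rewrite Cmod_mult, Cmod_pow.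
          replace (Cmod w) with (r1 * x) by (unfold x; field; lra).
          specialize (HM (S (n + j))). rewrite Cmod_mult, Cmod_pow, Cmod_R, Rabs_pos_eq in HM by lra.
          rewrite Rpow_mult_distr, <- Rmult_assoc.
          replace (S (n + j)) with (S n + j)%nat in * by lia. rewrite (pow_add x), <- Rmult_assoc.
          apply Rmult_le_compat.
          apply Rmult_le_pos; [apply Rmult_le_pos; [apply Cmod_ge_0 | apply pow_le; lra] | apply pow_le; lra].
          apply pow_le; lra.
          apply Rmult_le_compat_r. apply pow_le; lra. exact HM.
          apply pow_incr; lra. }
        simpl (pow (/ 2) (S j)). lra. }
    destruct (Ceq_dec (c n) 0) as [E|NE]; [exact E | exfalso].
    apply Cmod_gt_0 in NE.
    set (K := M * / r1 ^ S n * 2).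
    assert (HK : 0 <= K).
    { unfold K. repeat apply Rmult_le_pos; try lra. apply Rlt_le, Rinv_0_lt_compat, pow_lt, R1. }
    set (e := Rmin (r1 / 2) (Cmod (c n) / (K + 1))).
    assert (He : 0 < e).
    { apply Rmin_pos. lra. apply Rdiv_lt_0_compat; lra. }
    destruct (Hz e He) as [z [[Hz1 Hz2] Hz3]].
    set (w := (z - z0)%C) in *.
    assert (Hw : Cmod w <= r1 / 2) by (apply Rlt_le, Rlt_le_trans with (1 := Hz2), Rmin_l).
    assert (P : Cmod (c n * w ^ n)%C <= K * Cmod w ^ S n).
    { apply le_epsilon. intros eps Heps.
      assert (Q := Hs z). fold w in Q.
      specialize (Q ltac:(unfold r1 in *; lra)). rewrite Hz3 in Q.
      apply is_pseries_C_iff with (eps := mkposreal eps Heps) in Q. destruct Q as [n0 Q]. simpl in Q.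
      specialize (Q (n + n0)%nat ltac:(lia)). specialize (T w Hw n0).
      set (s := @sum_n C_AbelianGroup (fun k => c k * w ^ k)%C (n + n0)) in *.
      replace (c n * w ^ n)%C with ((s - 0) + - (s - c n * w ^ n))%C by ring.
      eapply Rle_trans. apply Cmod_triangle. rewrite Cmod_opp.
      assert (T2 : M * (Cmod w / r1) ^ S n * (2 - 2 * (/ 2) ^ n0) <= K * Cmod w ^ S n).
      { unfold K, Rdiv. rewrite Rpow_mult_distr, pow_inv.
        replace (M * / r1 ^ S n * 2 * Cmod w ^ S n) with (M * (Cmod w ^ S n * / r1 ^ S n) * 2) by ring.
        apply Rmult_le_compat_l.
        { apply Rmult_le_pos; [exact HM0|]. apply Rmult_le_pos; [apply pow_le, Cmod_ge_0|].
          apply Rlt_le, Rinv_0_lt_compat, pow_lt, R1. }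
        pose proof (pow_le (/ 2) n0 ltac:(lra)). lra. }
      lra. }
    rewrite Cmod_mult, Cmod_pow in P.
    assert (P2 : Cmod (c n) <= K * Cmod w).
    { apply Rmult_le_reg_r with (Cmod w ^ n). now apply pow_lt.
      replace (K * Cmod w * Cmod w ^ n) with (K * Cmod w ^ S n) by (simpl; ring). exact P. }
    assert (P3 : Cmod w < Cmod (c n) / (K + 1)) by (apply Rlt_le_trans with (1 := Hz2), Rmin_r).
    apply Rmult_lt_compat_r with (r := K + 1) in P3; [|lra].
    unfold Rdiv in P3. rewrite Rmult_assoc, Rinv_l in P3 by lra. lra. }
  intros z Hzr. apply Hs in Hzr.
  apply (filterlim_locally_unique (K := C_AbsRing) (V := C_NormedModule) _ _ _ Hzr).
  apply (proj2 (is_pseries_C_iff c (z - z0)%C 0)).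
  intros eps. exists O. intros n _.
  assert (Z : @eq C (@sum_n C_AbelianGroup (fun k => c k * (z - z0) ^ k)%C n) 0).
  { induction n as [|n IHn]. rewrite sum_n_C_0, Hc. ring. rewrite sum_n_C_S, IHn, Hc. ring. }
  rewrite Z. replace (0 - 0)%C with (RtoC 0) by ring. rewrite Cmod_0. apply cond_pos.
Qed.

Lemma cut_plane_star (u : C) (t : R) : cut_plane u -> 0 <= t <= 1 -> cut_plane (t * u)%C.
Proof.
  intros Hu Ht [x [Hx E]]. apply Hu.
  assert (T : 0 < t).
  { destruct (proj1 Ht) as [T|T]; [exact T|]. rewrite <- T, Cmult_0_l in E. apply RtoC_inj in E. lra. }
  exists (/ t * x). split.
  - rewrite <- (Rmult_1_l 1). apply Rmult_le_compat; try lra.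
    rewrite <- Rinv_1. apply Rinv_le_contravar; lra.
  - rewrite RtoC_mult, <- E, RtoC_inv by lra. field. intros H. apply RtoC_inj in H. lra.
Qed.

(** On the ray from 0 to [u], let [T] be the supremum of the times up to which [h]
    vanishes.  The zeros accumulate at [T u], so [h] vanishes on a disc about this
    point, and [T] could be increased unless it is 1. *)
Lemma identity_theorem_cut_plane (h : C -> C) :
  (forall u, cut_plane u -> C_analytic_at h u) ->
  (forall u, Cmod u < 1 -> h u = 0) ->
  forall u, cut_plane u -> h u = 0.
Proof.
  intros Ha H1 u Hu.
  set (m := Cmod u + 1).
  assert (Hm : 0 < m) by (pose proof (Cmod_ge_0 u); unfold m; lra).
  assert (Hum : Cmod u < m) by (unfold m; lra).
  pose (E := fun t : R => 0 <= t <= 1 /\ forall s : R, 0 <= s <= t -> h (s * u)%C = 0).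
  assert (Ht0 : 0 < / m <= 1).
  { split. now apply Rinv_0_lt_compat. rewrite <- Rinv_1. apply Rinv_le_contravar; pose proof (Cmod_ge_0 u); unfold m; lra. }
  assert (E0 : E (/ m)).
  { split. lra. intros s Hs. apply H1. rewrite Cmod_mult, Cmod_R, Rabs_pos_eq by lra.
    apply Rle_lt_trans with (/ m * Cmod u). apply Rmult_le_compat_r. apply Cmod_ge_0. lra.
    apply Rmult_lt_reg_l with (1 := Hm). rewrite <- Rmult_assoc, Rinv_r; lra. }
  destruct (completeness E) as [T [HT1 HT2]].
  { exists 1. intros t [Ht _]. lra. }
  { eexists. exact E0. }
  assert (T0 : / m <= T) by (apply HT1, E0).
  assert (T1 : T <= 1) by (apply HT2; intros t [Ht _]; lra).
  assert (Hlt : forall s : R, 0 <= s < T -> h (s * u)%C = 0).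
  { intros s Hs. destruct (Ceq_dec (h (s * u)%C) 0) as [Z|NZ]; [exact Z | exfalso].
    apply (Rlt_irrefl T). apply Rle_lt_trans with s; [|lra].
    apply HT2. intros t [Ht Ht2]. destruct (Rle_lt_dec t s) as [L|L]; [exact L|].
    exfalso. apply NZ, Ht2. lra. }
  destruct (Req_dec (Cmod u) 0) as [U0|U0].
  { apply H1. rewrite U0. lra. }
  assert (UP : 0 < Cmod u) by (pose proof (Cmod_ge_0 u); lra).
  destruct (Ha (T * u)%C) as [c [r [Hr Hc]]]. { apply cut_plane_star; [exact Hu | lra]. }
  assert (D : forall s : R, Cmod (s * u - T * u)%C = Rabs (s - T) * Cmod u).
  { intros s. rewrite <- Cmod_R, <- Cmod_mult. f_equal. rewrite RtoC_minus. ring. }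
  assert (Hdisc : forall z, Cmod (z - T * u)%C < r -> h z = 0).
  { apply (analytic_zeros_isolated c h (T * u)%C r Hr Hc).
    intros eps Heps. set (g := Rmin T (eps / m) / 2).
    assert (G0 : 0 < g).
    { unfold g. assert (0 < Rmin T (eps / m)); [|lra]. apply Rmin_pos. lra. now apply Rdiv_lt_0_compat. }
    assert (G1 : g < T) by (unfold g in *; pose proof (Rmin_l T (eps / m)); lra).
    assert (G2 : g < eps / m) by (unfold g in *; pose proof (Rmin_r T (eps / m)); lra).
    exists (RtoC (T - g) * u)%C. split; [|apply Hlt; lra].
    rewrite D. replace (T - g - T) with (- g) by ring. rewrite Rabs_Ropp, Rabs_pos_eq by lra.
    split. now apply Rmult_lt_0_compat.
    apply Rle_lt_trans with (g * m). apply Rmult_le_compat_l; lra.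
    apply Rmult_lt_reg_r with (/ m). lra. rewrite Rmult_assoc, Rinv_r by lra. unfold Rdiv in G2. lra. }
  set (T' := Rmin 1 (T + r / (2 * m))).
  assert (Hstep : 0 < r / (2 * m)) by (apply Rdiv_lt_0_compat; lra).
  assert (ET : E T').
  { split. unfold T'. split. apply Rmin_glb; lra. apply Rmin_l.
    intros s Hs. destruct (Rlt_le_dec s T) as [L|L]. apply Hlt; lra.
    apply Hdisc. rewrite D, Rabs_pos_eq by lra.
    assert (s - T <= r / (2 * m)) by (pose proof (Rmin_r 1 (T + r / (2 * m))); unfold T' in *; lra).
    apply Rle_lt_trans with (r / (2 * m) * m).
    apply Rmult_le_compat; lra.
    replace (r / (2 * m) * m) with (r / 2) by (field; lra). lra. }
  assert (L : T' <= T) by (apply HT1, ET).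
  assert (TE : T = 1).
  { unfold T' in L. unfold Rmin in L. destruct Rle_dec; lra. }
  apply Hdisc. rewrite TE. replace (u - 1 * u)%C with (RtoC 0) by ring. rewrite Cmod_0. exact Hr.
Qed.

Lemma is_hyp2F1_unique al be ga f : is_hyp2F1 al be ga f ->
  forall u, cut_plane u -> hyp2F1 al be ga u = f u.
Proof.
  intros Hf. pose proof (epsilon_spec (inhabits (fun _ : C => RtoC 0)) _ (ex_intro _ f Hf)) as Hg.
  fold (hyp2F1 al be ga) in Hg. destruct Hf as [F1 F2], Hg as [G1 G2].
  intros u Hu. apply Ceq_minus.
  apply (identity_theorem_cut_plane (fun v => hyp2F1 al be ga v - f v)%C); [| |exact Hu].
  - intros v Hv. now apply C_analytic_at_minus; auto.
  - intros v Hv. apply (proj1 (Ceq_minus _ _)).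
    apply (filterlim_locally_unique (K := C_AbsRing) (V := C_NormedModule) _ _ _ (G1 v Hv) (F1 v Hv)).
Qed.

Lemma hyp2F1_euler p q N u : cut_plane u ->
  hyp2F1 (RtoC (INR N / 2)) (RtoC (INR (p + 1))) (RtoC (INR (p + q + 2))) u
  = (RtoC (/ beta_factor p q) * euler_integral p q N u)%C.
Proof.
  apply (is_hyp2F1_unique _ _ _ (fun u => RtoC (/ beta_factor p q) * euler_integral p q N u)%C).
  pose proof (beta_factor_neq_0 p q) as B.
  split.
  - intros v Hv.
    assert (S := euler_integral_pseries p q N 0 v 1 Rlt_0_1 cut_plane_0_distance).
    replace (v - 0)%C with v in S by ring. specialize (S Hv).
    apply (is_pseries_scal (K := C_AbsRing) (V := C_NormedModule) (RtoC (/ beta_factor p q))) in S;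
      [|apply Cmult_comm].
    revert S. apply is_series_ext. intros n. f_equal. unfold PS_scal. rewrite euler_coef_0.
    change (@scal _ _ ?a ?b) with (a * b)%C. rewrite Cmult_assoc, <- RtoC_mult, Rinv_l by exact B.
    as_C_equation. ring.
  - intros v Hv. destruct (cut_plane_distance v Hv) as [d [Hd Hz]].
    exists (PS_scal (K := C_AbsRing) (V := C_NormedModule) (RtoC (/ beta_factor p q)) (euler_coef p q N v)), d.
    split; [exact Hd|]. intros z Hzd.
    apply (is_pseries_scal (K := C_AbsRing) (V := C_NormedModule) (RtoC (/ beta_factor p q))).
    apply Cmult_comm. now apply euler_integral_pseries with d.
Qed.

(** * The functional equation of the Gamma function *)

(** Taking logarithms, [y ln t - t <= y ln y] because [ln (t / y) <= t / y]. *)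
Lemma Rpower_exp_le y t : 0 < y -> 0 < t -> Rpower t y * exp (- t) <= Rpower y y.
Proof.
  intros Hy Ht. unfold Rpower. rewrite <- exp_plus.
  assert (H : y * ln t + - t <= y * ln y).
  { replace t with (y * (t / y)) at 1 by (field; lra).
    assert (P : 0 < t / y) by (apply Rdiv_lt_0_compat; lra).
    rewrite ln_mult by lra.
    assert (L : ln (t / y) <= t / y).
    { apply Rlt_le. rewrite <- (ln_exp (t / y)) at 2. apply ln_increasing. exact P.
      pose proof (exp_ineq1 (t / y) ltac:(lra)). lra. }
    apply Rmult_le_compat_l with (r := y) in L; [|lra].
    replace (y * (t / y)) with t in L by (field; lra). lra. }
  destruct H as [H|H]; [left; now apply exp_increasing | right; now rewrite H].
Qed.

(** The limit is the supremum of the integrals over compact intervals. *)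
Lemma ex_RInt_gen_nonneg_bounded (f : R -> R) (K : R) :
  (forall t, 0 < t -> continuous f t) -> (forall t, 0 < t -> 0 <= f t) ->
  (forall a b, 0 < a -> a <= b -> RInt f a b <= K) ->
  ex_RInt_gen f (at_right 0) (Rbar_locally p_infty).
Proof.
  intros Hc Hp HK.
  assert (Hex : forall a b, 0 < a -> a <= b -> ex_RInt f a b).
  { intros a b Ha Hb. apply (ex_RInt_continuous (V := R_CompleteNormedModule)).
    rewrite Rmin_left, Rmax_right by exact Hb. intros t Ht. apply Hc. lra. }
  destruct (completeness (fun v => exists a b, 0 < a /\ a <= b /\ v = RInt f a b)) as [l [Hl1 Hl2]].
  { exists K. intros v [a [b [Ha [Hb ->]]]]. now apply HK. }
  { exists (RInt f 1 1), 1, 1. repeat split; lra. }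
  exists l. apply (filterlimi_locally (U := R_UniformSpace)).
  intros eps.
  assert (H : exists a0 b0, 0 < a0 /\ a0 <= b0 /\ l - eps < RInt f a0 b0).
  { apply Classical_Prop.NNPP. intros N. apply (Rlt_irrefl l).
    apply Rle_lt_trans with (l - eps); [|pose proof (cond_pos eps); lra].
    apply Hl2. intros v [a [b [Ha [Hb ->]]]]. apply Rnot_lt_le. intros L. apply N.
    now exists a, b. }
  destruct H as [a0 [b0 [Ha0 [Hb0 H0]]]].
  apply Filter_prod with (fun a => 0 < a < a0) (fun b => b0 < b).
  - exists (mkposreal a0 Ha0). intros y Hy Hy2. change (Rabs (y - 0) < a0) in Hy.
    rewrite Rminus_0_r, Rabs_pos_eq in Hy; lra.
  - exists b0. auto.
  - intros a b Ha Hb. simpl. exists (RInt f a b). split.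
    + apply (RInt_correct (V := R_CompleteNormedModule)). apply Hex; lra.
    + change (Rabs (RInt f a b - l) < eps).
      assert (U : RInt f a b <= l) by (apply Hl1; exists a, b; repeat split; lra).
      assert (L : RInt f a0 b0 <= RInt f a b).
      { rewrite <- (RInt_Chasles f a a0 b), <- (RInt_Chasles f a0 b0 b) by (apply Hex; lra).
        change plus with Rplus.
        assert (0 <= RInt f a a0) by (apply RInt_ge_0; [lra | apply Hex; lra | intros; apply Hp; lra]).
        assert (0 <= RInt f b0 b) by (apply RInt_ge_0; [lra | apply Hex; lra | intros; apply Hp; lra]).
        lra. }
      apply Rabs_def1; lra.
Qed.

Lemma continuous_Gamma_integrand y t : 0 < t ->
  continuous (fun t => Rpower t y * exp (- t)) t.
Proof.
  intros Ht. apply (ex_derive_continuous (V := R_NormedModule)).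
  unfold Rpower. auto_derive. exact Ht.
Qed.

(** A single comparison function handles both ends of the half-line: the integrand
    is at most the derivative of the bounded function [B/x * t^x / (1 + t^x)], as
    soon as [B] bounds [(1 + t^x)^2 exp (-t) <= (2 + 2 t^(2x)) exp (-t)]. *)
Lemma is_RInt_gen_Gamma x : 0 < x ->
  is_RInt_gen (fun t => Rpower t (x - 1) * exp (- t)) (at_right 0) (Rbar_locally p_infty) (Gamma x).
Proof.
  intros Hx. unfold Gamma. apply (RInt_gen_correct (V := R_CompleteNormedModule)).
  set (B := 2 + 2 * Rpower (2 * x) (2 * x)).
  apply ex_RInt_gen_nonneg_bounded with (B / x).
  - intros t Ht. now apply continuous_Gamma_integrand.
  - intros t _. apply Rmult_le_pos; apply Rlt_le, exp_pos.
  - intros a b Ha Hb.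
    set (G := fun t => B / x * (Rpower t x / (1 + Rpower t x))).
    set (dG := fun t => B * Rpower t (x - 1) / (1 + Rpower t x) ^ 2).
    assert (Pp : forall t y, 0 < Rpower t y) by (intros; apply exp_pos).
    assert (HC : 0 < B) by (unfold B; pose proof (Pp (2 * x) (2 * x)); lra).
    assert (I : is_RInt dG a b (G b - G a)).
    { apply (is_RInt_derive (V := R_CompleteNormedModule) G dG); rewrite Rmin_left, Rmax_right by exact Hb; intros t Ht.
      - unfold G, dG. unfold Rpower at 1 2. auto_derive.
        + pose proof (exp_pos (x * ln t)). repeat split; lra.
        + fold (Rpower t x). replace (Rpower t (x - 1)) with (Rpower t x / t).
          pose proof (Pp t x). field. repeat split; lra.
          unfold Rminus. rewrite Rpower_plus, Rpower_Ropp, Rpower_1 by lra. reflexivity.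
      - apply (ex_derive_continuous (V := R_NormedModule)).
        unfold dG, Rpower. auto_derive. pose proof (exp_pos (x * ln t)).
        repeat split; try lra. intros E. nra. }
    apply Rle_trans with (RInt dG a b).
    + apply RInt_le. exact Hb.
      apply (ex_RInt_continuous (V := R_CompleteNormedModule)).
      rewrite Rmin_left, Rmax_right by exact Hb. intros t Ht. apply continuous_Gamma_integrand. lra.
      eexists; exact I.
      intros t Ht. unfold dG.
      assert (E : (1 + Rpower t x) ^ 2 * exp (- t) <= B).
      { assert (E1 : exp (- t) <= 1).
        { rewrite <- exp_0. left. apply exp_increasing. lra. }
        assert (E2 := Rpower_exp_le (2 * x) t ltac:(lra) ltac:(lra)).
        replace (2 * x) with (x + x) in E2 at 1 by ring. rewrite Rpower_plus in E2.
        pose proof (exp_pos (- t)). pose proof (Pp t x).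
        apply Rle_trans with ((2 + 2 * (Rpower t x * Rpower t x)) * exp (- t)).
        apply Rmult_le_compat_r. lra. pose proof (Rle_0_sqr (1 - Rpower t x)). unfold Rsqr in *. lra.
        unfold B. lra. }
      pose proof (Pp t x). pose proof (Pp t (x - 1)).
      assert (Q : 0 < (1 + Rpower t x) ^ 2) by (apply pow_lt; lra).
      apply Rmult_le_reg_r with (1 := Q).
      replace (B * Rpower t (x - 1) / (1 + Rpower t x) ^ 2 * (1 + Rpower t x) ^ 2) with (Rpower t (x - 1) * B) by (field; lra).
      rewrite Rmult_assoc. apply Rmult_le_compat_l; lra.
    + rewrite (is_RInt_unique _ _ _ _ I). unfold G.
      assert (F : forall t, 0 < Rpower t x / (1 + Rpower t x) < 1).
      { intros t. pose proof (Pp t x). split. apply Rdiv_lt_0_compat; lra.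
        apply Rmult_lt_reg_r with (1 + Rpower t x). lra. unfold Rdiv. rewrite Rmult_assoc, Rinv_l; lra. }
      pose proof (F a). pose proof (F b).
      assert (0 < B / x) by (apply Rdiv_lt_0_compat; lra). nra.
Qed.

(** Integrate the derivative of [t^x exp (-t)], which vanishes at both ends. *)
Lemma Gamma_succ x : 0 < x -> Gamma (x + 1) = x * Gamma x.
Proof.
  intros Hx.
  set (P := fun t => Rpower t x * exp (- t)).
  assert (D : forall t, 0 < t -> is_derive P t (x * (Rpower t (x - 1) * exp (- t)) - Rpower t (x + 1 - 1) * exp (- t))).
  { intros t Ht. unfold P, Rpower at 1. auto_derive. lra.
    fold (Rpower t x). replace (x + 1 - 1) with x by ring.
    replace (Rpower t (x - 1)) with (Rpower t x / t).
    field. lra. unfold Rminus. rewrite Rpower_plus, Rpower_Ropp, Rpower_1 by lra. reflexivity. }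
  assert (Hd : filter_prod (at_right 0) (Rbar_locally p_infty) (fun ab : R * R => forall t,
    Rmin (fst ab) (snd ab) <= t <= Rmax (fst ab) (snd ab) -> 0 < t)).
  { apply Filter_prod with (fun a => 0 < a) (fun b => 0 < b).
    - exists (mkposreal 1 Rlt_0_1). auto.
    - exists 0. auto.
    - intros a b Ha Hb t Ht. simpl in Ht. apply Rlt_le_trans with (2 := proj1 Ht). now apply Rmin_pos. }
  assert (I1 : is_RInt_gen (Derive P) (at_right 0) (Rbar_locally p_infty) (0 - 0)).
  { apply is_RInt_gen_Derive.
    - revert Hd. apply filter_imp. intros ab H t Ht. eexists. apply D. now apply H with (1 := Ht).
    - revert Hd. apply filter_imp. intros ab H t Ht. specialize (H t Ht).
      apply continuous_ext_loc with (fun t => x * (Rpower t (x - 1) * exp (- t)) - Rpower t (x + 1 - 1) * exp (- t)).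
      + exists (mkposreal t H). intros s Hs. symmetry. apply is_derive_unique, D.
        change (Rabs (s - t) < t) in Hs. apply Rabs_def2 in Hs. lra.
      + apply (ex_derive_continuous (V := R_NormedModule)). unfold Rpower. auto_derive. repeat split; exact H.
    - apply filterlim_locally. intros eps.
      exists (mkposreal (Rpower eps (/ x)) (exp_pos _)). intros t Ht Ht2.
      change (Rabs (t - 0) < Rpower eps (/ x)) in Ht. rewrite Rminus_0_r, Rabs_pos_eq in Ht by lra.
      change (Rabs (P t - 0) < eps). unfold P.
      pose proof (exp_pos (- t)). pose proof (exp_pos (x * ln t)) as Q. fold (Rpower t x) in Q.
      rewrite Rminus_0_r, Rabs_pos_eq by (apply Rmult_le_pos; lra).
      assert (E1 : exp (- t) <= 1).
      { rewrite <- exp_0. left. apply exp_increasing. lra. }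
      apply Rle_lt_trans with (Rpower t x). rewrite <- (Rmult_1_r (Rpower t x)) at 2. apply Rmult_le_compat_l; lra.
      apply (conj Ht2), (Rlt_Rpower_l _ _ x Hx) in Ht.
      rewrite Rpower_mult, Rinv_l, Rpower_1 in Ht by (try lra; apply cond_pos). exact Ht.
    - apply filterlim_locally. intros eps.
      set (B := Rpower (x + 1) (x + 1)). assert (HC : 0 < B) by apply exp_pos.
      pose proof (cond_pos eps) as He.
      exists (B / eps). intros t Ht. assert (0 < B / eps) by now apply Rdiv_lt_0_compat.
      change (Rabs (P t - 0) < eps). unfold P.
      pose proof (exp_pos (- t)). pose proof (exp_pos (x * ln t)) as Q. fold (Rpower t x) in Q.
      rewrite Rminus_0_r, Rabs_pos_eq by (apply Rmult_le_pos; lra).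
      assert (E := Rpower_exp_le (x + 1) t ltac:(lra) ltac:(lra)).
      rewrite Rpower_plus, Rpower_1 in E by lra. fold B in E.
      apply Rmult_lt_reg_r with t. lra.
      apply Rle_lt_trans with B. lra.
      apply Rmult_lt_compat_r with (r := eps) in Ht; [|exact He].
      unfold Rdiv in Ht. rewrite Rmult_assoc, Rinv_l in Ht by lra. lra. }
  assert (I2 : is_RInt_gen (Derive P) (at_right 0) (Rbar_locally p_infty) (x * Gamma x - Gamma (x + 1))).
  { assert (Hx1 : 0 < x + 1) by lra.
    generalize (is_RInt_gen_minus (V := R_NormedModule) _ _ _ _
      (is_RInt_gen_scal (V := R_NormedModule) _ x _ (is_RInt_gen_Gamma x Hx)) (is_RInt_gen_Gamma (x + 1) Hx1)).
    apply is_RInt_gen_ext.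
    revert Hd. apply filter_imp. intros ab H t Ht. symmetry. apply is_derive_unique, D, H. lra. }
  assert (E := eq_trans (eq_sym (is_RInt_gen_unique _ _ I1)) (is_RInt_gen_unique _ _ I2)). lra.
Qed.

(** * The functions Ktilde *)

(** At [x = 0] both sides are 0, so quotients of values of [Gamma] can be moved
    between real and complex numbers whatever these values are. *)
Lemma Cinv_RtoC x : (/ RtoC x)%C = RtoC (/ x).
Proof.
  destruct (Req_dec x 0) as [->|H]; [|now rewrite RtoC_inv].
  rewrite Rinv_0. apply injective_projections; simpl; unfold Rdiv; ring.
Qed.

Definition Ktilde_factor (p q N : nat) : R :=
  Gamma (INR N / 2) / Gamma (INR (p + q + 2)) / beta_factor p q.

Lemma Ktilde_euler p q m N u : dtilde m (S q) (S p) = INR N / 2 -> cut_plane u ->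
  Ktilde (S q) (S p) u m = (RtoC (Ktilde_factor p q N) * euler_integral p q N u)%C.
Proof.
  intros Hd Hu. unfold Ktilde, Ktilde_factor. rewrite Hd.
  replace (S q + S p)%nat with (p + q + 2)%nat by lia.
  replace (S p) with (p + 1)%nat by lia. rewrite hyp2F1_euler by exact Hu.
  unfold Rdiv, Cdiv. rewrite !RtoC_mult, Cinv_RtoC. ring.
Qed.

Lemma is_derive_C_scal (c : C) (f : C -> C) (z l : C) :
  @is_derive C_AbsRing C_NormedModule f z l ->
  @is_derive C_AbsRing C_NormedModule (fun v => c * f v)%C z (c * l)%C.
Proof.
  intros H. unfold is_derive.
  apply (@filterdiff_ext_lin C_AbsRing (AbsRing_NormedModule C_AbsRing) C_NormedModule) with
    (fun y : C_AbsRing => @scal C_AbsRing C_NormedModule c (@scal C_AbsRing C_NormedModule y l)).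
  - typeclasses eauto.
  - exact (@filterdiff_scal_r_fct C_AbsRing (AbsRing_NormedModule C_AbsRing) C_NormedModule _ _ c f
      (fun y : C_AbsRing => @scal C_AbsRing C_NormedModule y l) Cmult_comm H).
  - intros y. as_C_equation. change (c * (y * l) = y * (c * l))%C. ring.
Qed.

Lemma is_derive_Ktilde p q m N u : dtilde m (S q) (S p) = INR N / 2 -> cut_plane u ->
  @is_derive C_AbsRing C_NormedModule (fun v => Ktilde (S q) (S p) v m) u
   (RtoC (Ktilde_factor p q N) * (RtoC (INR N / 2) * euler_integral (S p) q (N + 2) u))%C.
Proof.
  intros Hd Hu.
  apply (is_derive_ext_loc (K := C_AbsRing) (V := C_NormedModule)) with
    (fun v => RtoC (Ktilde_factor p q N) * euler_integral p q N v)%C.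
  - destruct (cut_plane_distance u Hu) as [d [Hd0 Hz]].
    exists (mkposreal d Hd0). intros v Hv. symmetry. apply Ktilde_euler. exact Hd.
    now apply (cut_plane_ball u v d).
  - replace (S p) with (p + 1)%nat by lia.
    now apply is_derive_C_scal, is_derive_euler_integral.
Qed.

Lemma RtoC_INR_S_neq_0 n : RtoC (INR (S n)) <> 0.
Proof. intros H. apply RtoC_inj in H. revert H. apply not_0_INR. lia. Qed.

Lemma Gamma_half_succ N : (0 < N)%nat -> Gamma (INR (N + 2) / 2) = INR N / 2 * Gamma (INR N / 2).
Proof.
  intros HN. apply lt_0_INR in HN. rewrite <- Gamma_succ by lra. f_equal.
  rewrite plus_INR. simpl (INR 2). field.
Qed.

Lemma Ktilde_factor_N p q N : (0 < N)%nat ->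
  Ktilde_factor p q (N + 2) = INR N / 2 * Ktilde_factor p q N.
Proof.
  intros HN. unfold Ktilde_factor. rewrite Gamma_half_succ by exact HN. unfold Rdiv. ring.
Qed.

Lemma beta_factor_S p q :
  beta_factor (S p) q = INR (S p) / INR (p + q + 2) * beta_factor p q.
Proof.
  unfold beta_factor. replace (S p + q + 1)%nat with (S (p + q + 1)) by lia.
  replace (p + q + 2)%nat with (S (p + q + 1)) by lia.
  rewrite !fact_simpl, !mult_INR. field. split. apply INR_fact_neq_0. apply not_0_INR; lia.
Qed.

Lemma beta_factor_sym p q : beta_factor p q = beta_factor q p.
Proof. unfold beta_factor. rewrite (Nat.add_comm p q), (Rmult_comm (INR (fact p))). reflexivity. Qed.

Lemma Ktilde_factor_p p q N : (0 < N)%nat ->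
  Ktilde_factor (S p) q (N + 2) = INR N / 2 / INR (S p) * Ktilde_factor p q N.
Proof.
  intros HN. unfold Ktilde_factor. rewrite Gamma_half_succ by exact HN.
  replace (INR (S p + q + 2)) with (INR (p + q + 2) + 1).
  2:{ rewrite <- S_INR. f_equal. }
  assert (P : 0 < INR (p + q + 2)) by (apply lt_0_INR; lia).
  rewrite Gamma_succ, beta_factor_S by exact P.
  assert (P2 : INR (S p) <> 0) by (apply not_0_INR; lia).
  unfold Rdiv. rewrite !Rinv_mult, Rinv_inv.
  generalize (/ Gamma (INR (p + q + 2))) (/ beta_factor p q). intros g h. field. split; lra.
Qed.

Lemma Ktilde_factor_q p q N : (0 < N)%nat ->
  Ktilde_factor p (S q) (N + 2) = INR N / 2 / INR (S q) * Ktilde_factor p q N.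
Proof.
  intros HN.
  assert (Sym : forall r s M, Ktilde_factor r s M = Ktilde_factor s r M).
  { intros r s M. unfold Ktilde_factor. now rewrite beta_factor_sym, (Nat.add_comm r s). }
  rewrite Sym, Ktilde_factor_p by exact HN. now rewrite Sym.
Qed.

Theorem proposition2p5 :
  forall a b m : nat, (0 < a)%nat -> (0 < b)%nat -> (0 < m)%nat ->
  forall u : C, cut_plane u ->
    C_differentiable_at (fun v : C => Ktilde a b v m) u /\
    C_differentiable_at (fun v : C => Ktilde (a + 1) b v m) u /\
    Ktilde a b u (m + 2) =
      (RtoC (dtilde m a b) * Ktilde a b u m
       + u * C_derive (fun v : C => Ktilde a b v m) u)%C /\
    Ktilde a (b + 1) u m =
      (1 / RtoC (INR b) * C_derive (fun v : C => Ktilde a b v m) u)%C /\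
    Ktilde a (b + 1) u m =
      (Ktilde (a + 1) b u m
       + 1 / RtoC (INR b) * (u * C_derive (fun v : C => Ktilde (a + 1) b v m) u))%C /\
    (Ktilde a b u m <> RtoC 0 ->
      (RtoC (INR (a + b)) / RtoC (dtilde m a b)
         * (Ktilde (a + 1) b u m / Ktilde a b u m))%C =
      (hyp2F1 (RtoC (dtilde m a b + 1)) (RtoC (INR b)) (RtoC (INR (a + b + 1))) u
       / hyp2F1 (RtoC (dtilde m a b)) (RtoC (INR b)) (RtoC (INR (a + b))) u)%C).
Proof.
  intros a b m Ha Hb Hm u Hu.
  destruct a as [|q]; [lia|]. destruct b as [|p]; [lia|].
  (* Chosen so that [dtilde m a b = N / 2]; as [a], [b] and [m] are positive, the
     subtraction is exact and [N] is positive. *)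
  set (N := (2 * (S q + S p) + m - 4)%nat).
  assert (HN : (0 < N)%nat) by (unfold N; lia).
  assert (EN : INR N = 2 * (INR (S q) + INR (S p)) + INR m - 4).
  { unfold N. rewrite minus_INR, plus_INR, mult_INR, plus_INR by lia. simpl (INR 2). simpl (INR 4). ring. }
  assert (D0 : dtilde m (S q) (S p) = INR N / 2) by (unfold dtilde; lra).
  assert (EN2 : INR (N + 2) = INR N + 2) by (rewrite plus_INR; simpl (INR 2); ring).
  assert (Dm : dtilde (m + 2) (S q) (S p) = INR (N + 2) / 2).
  { unfold dtilde. rewrite (plus_INR m 2). simpl (INR 2). lra. }
  assert (Da : dtilde m (S (S q)) (S p) = INR (N + 2) / 2).
  { unfold dtilde. rewrite (S_INR (S q)). lra. }
  assert (Db : dtilde m (S q) (S (S p)) = INR (N + 2) / 2).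
  { unfold dtilde. rewrite (S_INR (S p)). lra. }
  replace (S q + 1)%nat with (S (S q)) by lia. replace (S p + 1)%nat with (S (S p)) by lia.
  assert (K0 := is_derive_Ktilde p q m N u D0 Hu).
  assert (K1 := is_derive_Ktilde p (S q) m (N + 2) u Da Hu).
  assert (E0 := is_C_derive_unique (fun v : C => Ktilde (S q) (S p) v m) _ _ K0).
  assert (E1 := is_C_derive_unique (fun v : C => Ktilde (S (S q)) (S p) v m) _ _ K1).
  rewrite E0, E1.
  assert (P1 : RtoC (INR (S p)) <> 0) by (apply RtoC_INR_S_neq_0).
  assert (P2 : RtoC (INR (S q)) <> 0) by (apply RtoC_INR_S_neq_0).
  split; [eexists; exact K0|]. split; [eexists; exact K1|].
  rewrite (Ktilde_euler _ _ _ _ _ Dm), (Ktilde_euler _ _ _ _ _ Db), (Ktilde_euler _ _ _ _ _ D0), D0 by exact Hu.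
  split; [|split; [|split]].
  - rewrite Ktilde_factor_N, euler_integral_contiguous by assumption.
    replace (p + 1)%nat with (S p) by lia. rewrite RtoC_mult. ring.
  - rewrite Ktilde_factor_p by exact HN.
    rewrite RtoC_mult, (RtoC_div (INR N / 2)) by (apply not_0_INR; lia). field. exact P1.
  - rewrite (Ktilde_euler _ _ _ _ _ Da), Ktilde_factor_p, Ktilde_factor_q by assumption.
    rewrite !RtoC_mult, !(RtoC_div (INR N / 2)) by (apply not_0_INR; lia).
    replace (euler_integral (S p) q (N + 2) u) with
      (/ RtoC (INR (S q)) * (RtoC (INR (S q)) * euler_integral (S p) q (N + 2) u))%C by (field; exact P2).
    rewrite euler_integral_by_parts by exact Hu. field. split; assumption.
  - rewrite <- (Ktilde_euler _ _ _ _ _ D0) by exact Hu. unfold Ktilde. rewrite Da, D0.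
    rewrite Gamma_half_succ by exact HN.
    replace (S (S q) + S p)%nat with (S q + S p + 1)%nat by lia.
    replace (INR (N + 2) / 2) with (INR N / 2 + 1) by lra.
    assert (C0 : 0 < INR (S q + S p)) by (apply lt_0_INR; lia).
    assert (N0 : 0 < INR N) by (apply lt_0_INR; lia).
    replace (Gamma (INR (S q + S p + 1))) with (INR (S q + S p) * Gamma (INR (S q + S p))).
    2:{ rewrite <- Gamma_succ by exact C0. f_equal. rewrite (plus_INR _ 1). reflexivity. }
    generalize (hyp2F1 (RtoC (INR N / 2 + 1)) (RtoC (INR (S p))) (RtoC (INR (S q + S p + 1))) u).
    generalize (hyp2F1 (RtoC (INR N / 2)) (RtoC (INR (S p))) (RtoC (INR (S q + S p))) u).
    generalize (Gamma (INR N / 2)) (Gamma (INR (S q + S p))). intros g h F F' HK.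
    assert (g0 : RtoC g <> 0) by (intros E; apply HK; rewrite E; unfold Cdiv; ring).
    assert (F0 : F <> 0) by (intros E; apply HK; rewrite E; ring).
    assert (h0 : RtoC h <> 0).
    { intros E. apply HK. rewrite E. unfold Cdiv. rewrite Cinv_RtoC, Rinv_0. ring. }
    rewrite !RtoC_mult. field. repeat split; try assumption; intros E; apply RtoC_inj in E; lra.
Qed.
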